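(* Let $Y$ be a real Hilbert space, $\mathcal{A}\colon X\to Y$ a compact linear operator, $F_0\colon Y\to H$ and $g_0=(g_{01},\dots,g_{0m})\colon Y\to\mathbb{R}^m$ continuously differentiable maps, and suppose that the constraints of problem $(\mathcal{P})$ have the form $F(x)=F_0(\mathcal{A}x)$, $g(x)=g_0(\mathcal{A}x)$ for all $x\in X$. Let $f_*$ be the optimal value of $(\mathcal{P})$ and suppose that: (1) $f$, $F_0$, and $g_0$ are twice continuously Fréchet differentiable, $\phi$ is continuously differentiable on its effective domain, and $\phi'(0)>0$; (2) the functions $f$ and $(x,\lambda,\mu)\mapsto\mathcal{L}(x,\lambda,\mu,c)$, $c>0$, are weakly sequentially lower semicontinuous; (3) the set $\Omega_r(f_*+\varepsilon)=\{x\in\Omega\mid f(x)+r(\|F(x)\|^2+|\max\{g(x),0\}|^2)\le f_*+\varepsilon\}$ is bounded for some $r>0$ and $\varepsilon>0$; (4) the functions $f$, $g_i$, $i\in M$, and $F$, as well as their first and second order Fréchet derivatives, are bounded on $\Omega_r(f_*+\varepsilon)$; (5) the operator $\mathcal{A}\mathcal{A}^*$ is the identity map; (6) for any globally optimal solution $x_*$ of $(\mathcal{P})$ the function $Q_0(y)[\cdot]$ is positive definite at the point $y=\mathcal{A}x_*$. Then the augmented Lagrangian $\mathcal{L}(x,\lambda,\mu,c)$ is globally exact.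
   Context: Setting. $X$ and $H$ are real Hilbert spaces, $M=\{1,\dots,m\}$, and $f,g_i\colon X\to\mathbb{R}$ ($i\in M$), $F\colon X\to H$ are continuously Fréchet differentiable; $g=(g_1,\dots,g_m)$. Problem $(\mathcal{P})$: minimise $f(x)$ subject to $F(x)=0$, $g_i(x)\le 0$, $i\in M$. It is assumed that $(\mathcal{P})$ has a globally optimal solution. $|\cdot|$ is the Euclidean norm; $\max\{y,z\}$ of vectors is taken coordinatewise; $\nabla g_0(y)v\in\mathbb{R}^m$ is the vector with coordinates $\langle\nabla g_{0i}(y),v\rangle$; $DF(x)[\cdot]\colon X\to H$ is the Fréchet derivative; $A^*$ denotes the adjoint of a bounded linear operator $A$; $\mathrm{diag}(\cdot)$ is the diagonal matrix. Product spaces carry the Hilbert product norm. The function $\phi\colon[0,+\infty)\to[0,+\infty]$ is convex, non-decreasing, lower semicontinuous, $\phi(t)=0$ iff $t=0$, $\mathrm{dom}\,\phi\ne\{0\}$, and either $\mathrm{dom}\,\phi=[0,+\infty)$ and $\phi(t)\to+\infty$ as $t\to\infty$, or $\mathrm{dom}\,\phi=[0,\alpha)$ for some $\alpha>0$ and $\phi(t)\to+\infty$ as $t\to\alpha$. The function $\psi\colon[0,+\infty)^m\to\mathbb{R}$ is continuously differentiable and concave, $\psi(0)>0$, $0$ is a global maximum point of $\psi$, and $\frac{\partial\psi}{\partial y_i}(y)=0$ whenever $y\in[0,+\infty)^m$, $y_i=0$. Put $b(x)=\psi(\max\{g(x),0\})$, $p(x,\mu)=b(x)/(1+|\mu|^2)$,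 $\Omega=\{x\in X\mid b(x)>0,\ \phi(\|F(x)\|^2)<+\infty\}$, $L(x,\lambda,\mu)=f(x)+\langle\lambda,F(x)\rangle+\langle\mu,g(x)\rangle$ for $\lambda\in H$, $\mu\in\mathbb{R}^m$, and $$\eta(x,\lambda,\mu)=\tfrac12\big\|DF(x)[\nabla_xL(x,\lambda,\mu)]\big\|^2+\tfrac12\sum_{i=1}^m\big(\langle\nabla g_i(x),\nabla_xL(x,\lambda,\mu)\rangle+g_i(x)^2\mu_i\big)^2.$$ For $c>0$ the augmented Lagrangian is $$\mathcal{L}(x,\lambda,\mu,c)=f(x)+\langle\lambda,F(x)\rangle+\tfrac c2(1+\|\lambda\|^2)\phi(\|F(x)\|^2)+\langle\mu,q\rangle+\tfrac{c}{2p(x,\mu)}|q|^2+\eta(x,\lambda,\mu),\quad q=\max\{g(x),-\tfrac1c p(x,\mu)\mu\},$$ if $x\in\Omega$, and $\mathcal{L}(x,\lambda,\mu,c)=+\infty$ otherwise. For $y\in Y$ put $$Q_0(y)[\lambda,\mu]=\tfrac12\Big\|DF_0(y)\Big[DF_0(y)^*[\lambda]+\sum_{i=1}^m\mu_i\nabla g_{0i}(y)\Big]\Big\|^2+\tfrac12\Big|\nabla g_0(y)\Big(DF_0(y)^*[\lambda]+\sum_{i=1}^m\mu_i\nabla g_{0i}(y)\Big)+\mathrm{diag}(g_{0i}(y)^2)\mu\Big|^2.$$ $Q_0(y)[\cdot]$ is positive definite if there is $a>0$ with $Q_0(y)[\lambda,\mu]\ge a(\|\lambda\|^2+|\mu|^2)$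 for all $\lambda\in H,\mu\in\mathbb{R}^m$. A triplet $(x_*,\lambda_*,\mu_* )\in X\times H\times\mathbb{R}^m$ is a KKT-point of $(\mathcal{P})$ if $\nabla_xL(x_*,\lambda_*,\mu_* )=0$, $F(x_* )=0$, $\max\{g(x_* ),-\mu_*\}=0$. Standing assumption: for every globally optimal solution $x_*$ of $(\mathcal{P})$ there exist $\lambda_*,\mu_*$ such that $(x_*,\lambda_*,\mu_* )$ is a KKT-point. The augmented Lagrangian is called globally exact if there exists $c_*>0$ such that for all $c\ge c_*$ a triplet $(x_*,\lambda_*,\mu_* )$ is a global minimiser of $\mathcal{L}(\cdot,c)$ over $X\times H\times\mathbb{R}^m$ if and only if $x_*$ is a globally optimal solution of $(\mathcal{P})$ and $(x_*,\lambda_*,\mu_* )$ is a KKT-point of $(\mathcal{P})$. *)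

(* Defs.v *)
From HB Require Import structures.
From mathcomp Require Import all_boot all_order all_algebra.
From mathcomp Require Import all_classical all_reals all_analysis.

Set Implicit Arguments.
Unset Strict Implicit.
Unset Printing Implicit Defensive.

Import Order.TTheory GRing.Theory Num.Theory.
Import numFieldNormedType.Exports.

Local Open Scope classical_set_scope.
Local Open Scope ring_scope.

HB.mixin Record CompleteNormedModule_isHilbert (R : realType) X
    of CompleteNormedModule R X := {
  inner : X -> X -> R ;
  innerC : forall x y, inner x y = inner y x ;
  inner_linearl : forall a x y z,
    inner (a *: x + y) z = a * inner x z + inner y z ;
  inner_norm : forall x, inner x x = `|x| ^+ 2
}.

#[short(type="hilbertType")]
HB.structure Definition Hilbert (R : realType) :=
  {X of CompleteNormedModule_isHilbert R X & CompleteNormedModule R X}.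

Section Hilbert_operators.
Context {R : realType}.

Definition grad {X : hilbertType R} (f : X -> R) (x : X) : X :=
  xget 0 [set w | forall v, 'd f x v = inner w v].

Definition adjoint {X Y : hilbertType R} (T : X -> Y) (y : Y) : X :=
  xget 0 [set x | forall v, inner (T v) y = inner v x].

Definition compact_operator {V W : normedModType R} (T : V -> W) : Prop :=
  forall B : set V, bounded_set B -> precompact (T @` B).

(* On a product or on ['rV_m] the library norm is a maximum norm; it has the same
   topology, hence the same continuous linear functionals, as the Hilbert one. *)
Definition weakly_cvg {V : normedModType R} (u : V^nat) (l : V) : Prop :=
  forall xi : {linear V -> R^o}, continuous xi -> (xi (u n) @[n --> \oo] --> xi l).

Definition weakly_seq_lsc {V : normedModType R} (h : V -> \bar R) : Prop :=
  forall (u : V^nat) (l : V), weakly_cvg u l ->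
    (h l <= limn_einf (fun n => h (u n)))%E.

End Hilbert_operators.

(* The space of bounded linear (or bilinear) maps with its operator norm is not
   available as a normed module, so statements about derivatives as elements of
   that space are spelled out through operator-norm inequalities. *)

Section Smoothness.
Context {R : realType} {V W : normedModType R}.
Implicit Types (f : V -> W) (S : set V).

Definition C1 f : Prop :=
  (forall x, differentiable f x) /\
  (forall x (e : R), 0 < e -> \forall y \near x,
     forall v, `|'d f y v - 'd f x v| <= e * `|v|).

Definition is_diff2 f (x : V) (B : V -> V -> W) : Prop :=
  [/\ forall h, linear (B h),
      forall v, linear (B ^~ v),
      exists M : R, forall h v, `|B h v| <= M * `|h| * `|v| &
      forall e : R, 0 < e -> \forall y \near x, forall v,
        `|'d f y v - 'd f x v - B (y - x) v| <= e * `|y - x| * `|v|].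

Definition d2 f (x : V) : V -> V -> W :=
  xget (fun _ _ => 0) [set B | is_diff2 f x B].

Definition C2 f : Prop :=
  [/\ C1 f,
      forall x, is_diff2 f x (d2 f x) &
      forall x (e : R), 0 < e -> \forall y \near x,
        forall h v, `|d2 f y h v - d2 f x h v| <= e * `|h| * `|v|].

Definition bounded_up_to_order2 f S : Prop :=
  exists M : R, forall x, S x ->
    [/\ `|f x| <= M,
        forall v, `|'d f x v| <= M * `|v| &
        forall h v, `|d2 f x h v| <= M * `|h| * `|v|].

(* Continuous differentiability relative to a set that need not be open: at
   points of D the difference quotients only involve points of D, so the
   derivatives are one-sided on the boundary. *)
Definition C1_within (D : set V) f (df : V -> V -> W) : Prop :=
  (forall x, D x -> forall e : R, 0 < e -> \forall y \near within D (nbhs x),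
     `|f y - f x - df x (y - x)| <= e * `|y - x|) /\
  (forall x, D x -> forall e : R, 0 < e -> \forall y \near within D (nbhs x),
     forall v, `|df y v - df x v| <= e * `|v|).

End Smoothness.

(* The library norm on ['rV_m] is the maximum norm. *)
Definition dotv {R : realType} {m : nat} (u v : 'rV[R]_m) : R :=
  \sum_i u 0 i * v 0 i.

Definition enorm {R : realType} {m : nat} (u : 'rV[R]_m) : R :=
  Num.sqrt (dotv u u).

Definition vmax {R : realType} {m : nat} (u v : 'rV[R]_m) : 'rV[R]_m :=
  \row_i Num.max (u 0 i) (v 0 i).

Definition orthant (R : realType) (m : nat) : set 'rV[R]_m :=
  [set y | forall i, 0 <= y 0 i].

(* phi and psi are total functions here; only their values on [0, +oo) and on the
   nonnegative orthant are constrained or used. *)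

Section Phi_psi.
Context {R : realType}.

Definition edom (phi : R -> \bar R) : set R :=
  [set t | 0 <= t /\ (phi t < +oo)%E].

(* In [\bar R], 0 * +oo = 0, so a = 0 and a = 1 in the convexity clause are
   harmless. *)
Definition phi_admissible (phi : R -> \bar R) : Prop :=
  [/\ forall t : R, 0 <= t -> (0 <= phi t)%E,
      forall s t a : R, 0 <= s -> 0 <= t -> 0 <= a <= 1 ->
        (phi (a * s + (1 - a) * t)%R
           <= a%:E * phi s + (1 - a)%R%:E * phi t)%E,
      forall s t : R, 0 <= s -> s <= t -> (phi s <= phi t)%E &
      forall t a : R, 0 <= t -> (a%:E < phi t)%E ->
        \forall s \near within [set s | 0 <= s] (nbhs t), (a%:E < phi s)%E] /\
  [/\ forall t, 0 <= t -> (phi t = 0%E <-> t = 0),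
      edom phi <> [set 0] &
      (edom phi = [set t | 0 <= t] /\ phi t @[t --> +oo] --> +oo%E) \/
      (exists alpha : R, [/\ 0 < alpha, edom phi = [set t | 0 <= t < alpha] &
                         phi t @[t --> alpha^'-] --> +oo%E])].

Definition psi_admissible {m : nat} (psi : 'rV[R]_m -> R) : Prop :=
  [/\ forall (y z : 'rV[R]_m) (a : R), orthant y -> orthant z -> 0 <= a <= 1 ->
        a * psi y + (1 - a) * psi z <= psi (a *: y + (1 - a) *: z),
      0 < psi 0,
      forall y, orthant y -> psi y <= psi 0 &
      (* dpsi y is the gradient of psi at y, one-sided on the boundary *)
      exists dpsi : 'rV[R]_m -> 'rV[R]_m,
        C1_within (@orthant R m) psi (fun y v => dotv (dpsi y) v) /\
        (forall y i, orthant y -> y 0 i = 0 -> dpsi y 0 i = 0)].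

End Phi_psi.

Section Problem.
Context {R : realType} {X H : hilbertType R} {m : nat}.
Variables (f : X -> R) (F : X -> H) (g : 'I_m -> X -> R).
Variables (phi : R -> \bar R) (psi : 'rV[R]_m -> R).

Definition gvec (x : X) : 'rV[R]_m := \row_i g i x.

Definition feasible : set X :=
  [set x | F x = 0 /\ forall i, g i x <= 0].

Definition globally_optimal (x : X) : Prop :=
  feasible x /\ forall y, feasible y -> f x <= f y.

Definition optimal_value : R := inf (f @` feasible).

Definition lagrangian (x : X) (l : H) (mu : 'rV[R]_m) : R :=
  f x + inner l (F x) + dotv mu (gvec x).

Definition grad_lagrangian (x : X) (l : H) (mu : 'rV[R]_m) : X :=
  grad (fun z => lagrangian z l mu) x.

Definition KKT (x : X) (l : H) (mu : 'rV[R]_m) : Prop :=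
  [/\ grad_lagrangian x l mu = 0, F x = 0 & vmax (gvec x) (- mu) = 0].

Definition slack (x : X) : R := psi (vmax (gvec x) 0).

Definition penalty_weight (x : X) (mu : 'rV[R]_m) : R := slack x / (1 + enorm mu ^+ 2).

Definition Omega : set X :=
  [set x | 0 < slack x /\ (phi (`|F x| ^+ 2)%R < +oo)%E].

Definition eta (x : X) (l : H) (mu : 'rV[R]_m) : R :=
  let w := grad_lagrangian x l mu in
  2^-1 * `|'d F x w| ^+ 2 +
  2^-1 * \sum_i (inner (grad (g i) x) w + g i x ^+ 2 * mu 0 i) ^+ 2.

(* On Omega the value of phi is finite, so [fine] does not lose information. *)
Definition augmented_lagrangian (c : R) (x : X) (l : H) (mu : 'rV[R]_m) :
    \bar R :=
  if `[< Omega x >] then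
    let q := vmax (gvec x) (- ((c^-1 * penalty_weight x mu) *: mu)) in
    (f x + inner l (F x)
       + c / 2 * (1 + `|l| ^+ 2) * fine (phi (`|F x| ^+ 2))
       + dotv mu q + c / (2 * penalty_weight x mu) * enorm q ^+ 2 + eta x l mu)%:E
  else +oo%E.

Definition Omega_sub (r gamma : R) : set X :=
  [set x | Omega x /\
     f x + r * (`|F x| ^+ 2 + enorm (vmax (gvec x) 0) ^+ 2) <= gamma].

Definition global_minimiser (c : R) (x : X) (l : H) (mu : 'rV[R]_m) : Prop :=
  forall x' l' mu',
    (augmented_lagrangian c x l mu <= augmented_lagrangian c x' l' mu')%E.

Definition globally_exact : Prop :=
  exists2 c0 : R, 0 < c0 & forall c, c0 <= c -> forall x l mu,
    global_minimiser c x l mu <-> globally_optimal x /\ KKT x l mu.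

End Problem.

Section Quadratic_form.
Context {R : realType} {Y H : hilbertType R} {m : nat}.
Variables (F0 : Y -> H) (g0 : 'I_m -> Y -> R).

Definition grad_g0 (y v : Y) : 'rV[R]_m := \row_i inner (grad (g0 i) y) v.

Definition Q0 (y : Y) (l : H) (mu : 'rV[R]_m) : R :=
  let w := adjoint ('d F0 y) l + \sum_i mu 0 i *: grad (g0 i) y in
  2^-1 * `|'d F0 y w| ^+ 2 +
  2^-1 * enorm (grad_g0 y w + mu *m diag_mx (\row_i g0 i y ^+ 2)) ^+ 2.

Definition Q0_positive_definite (y : Y) : Prop :=
  exists2 a : R, 0 < a &
    forall l mu, a * (`|l| ^+ 2 + enorm mu ^+ 2) <= Q0 y l mu.

End Quadratic_form.

(* Main.v *)
(* The proof compares values of [L = augmented_lagrangian c] directly: for large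
   c, any (x, l, mu) with L <= f_* is shown to be an optimal KKT point.

   Since A A^* = 1, only y = A x enters the constraints and A^* is an isometry.
   Put Phi = (F0, g0) : Y -> H x R^m, nu = (l, mu), D = diag (0, g0(y)^2). Then
   eta = |r|^2 / 2 with r = (dPhi dPhi^* + D) nu + dPhi (A grad f), and positive
   definiteness of Q0 makes dPhi dPhi^* + D coercive near an optimal y0, so that
   L <= f_* bounds nu. Let q = max (g, - p mu / c) and tau = - (F, q). A
   contraction argument solves Phi (y + h) - Phi y + D' z = tau for h = dPhi^* z
   with |z| = O(|tau|), where D' is D without the constraints active at y0. The
   point x + A^* h is feasible, and a second order expansion of f at x gives
     f_* <= f(x + A^* h)
         <= f(x) + <l, F> + <mu, q> + <r, z> + (active error) + O(|tau|^2),
   while L contains c (|F|^2 + |q|^2) and |r|^2 / 2. Hence r = 0 and tau = 0.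

   If the claim failed for arbitrarily large c, the offending points x_n would
   lie in a bounded set, and weak compactness, compactness of A and weak lower
   semicontinuity of f would give an optimal p with A x_n -> A p along a
   subsequence, contradicting the local statement at p. *)

Require Import Defs.
From HB Require Import structures.
From mathcomp Require Import all_boot all_order all_algebra.
From mathcomp Require Import all_classical all_reals all_analysis.
From mathcomp Require Import ring lra.

Set Implicit Arguments.
Unset Strict Implicit.
Unset Printing Implicit Defensive.

Import Order.TTheory GRing.Theory Num.Theory.
Import numFieldNormedType.Exports.

Local Open Scope classical_set_scope.
Local Open Scope ring_scope.

(** * Hilbert spaces *)

(** Using D' instead of D makes the comparison point feasible: a constraint active at y0 then obeys
    the unweighted equation, so its new value is g - q <= 0, while an inactive one stays negative by
    continuity. D and D' agree at y0, where active constraints vanish, so D' is still coercive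
    nearby. The price is the active error, the sum of g_i^2 |mu_i| |z| over active i. Where q_i =
    g_i it is O(|tau|^2); where q_i = - p mu_i / c, only |mu_i| <= (c / p) |tau| is available and
    the error grows with c. The term c |tau|^2 absorbs it because g_i is small near y0, so the
    neighbourhood must be fixed before c. The derivative bounds hold only on a sublevel set, so the
    segment towards the comparison point has to be shown to stay in it before f is expanded there.
    Once r = 0 and tau = 0, x is optimal and has KKT multipliers; r vanishes at them too, and r is
    affine and injective in nu, so they are nu. *)

Section Inner_product.
Context {R : realType} {X : hilbertType R}.
Implicit Types (x y z v : X) (a : R).

Lemma innerDl x y z : inner (x + y) z = inner x z + inner y z.
Proof. by rewrite -{1}[x]scale1r inner_linearl mul1r. Qed.

Lemma inner0l z : inner 0 z = 0.
Proof. by apply: (addrI (inner 0 z)); rewrite -innerDl !addr0. Qed.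

Lemma innerZl a x z : inner (a *: x) z = a * inner x z.
Proof. by rewrite -{1}[a *: x]addr0 inner_linearl inner0l addr0. Qed.

Lemma innerNl x z : inner (- x) z = - inner x z.
Proof. by rewrite -scaleN1r innerZl mulN1r. Qed.

Lemma innerBl x y z : inner (x - y) z = inner x z - inner y z.
Proof. by rewrite innerDl innerNl. Qed.

Lemma innerDr x y z : inner z (x + y) = inner z x + inner z y.
Proof. by rewrite innerC innerDl !(innerC z). Qed.

Lemma innerZr a x z : inner z (a *: x) = a * inner z x.
Proof. by rewrite innerC innerZl (innerC z). Qed.

Lemma inner0r z : inner z 0 = 0.
Proof. by rewrite innerC inner0l. Qed.

Lemma innerNr x z : inner z (- x) = - inner z x.
Proof. by rewrite innerC innerNl (innerC z). Qed.

Lemma innerBr x y z : inner z (x - y) = inner z x - inner z y.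
Proof. by rewrite innerDr innerNr. Qed.

Lemma inner_suml I (s : seq I) (P : pred I) (h : I -> X) z :
  inner (\sum_(i <- s | P i) h i) z = \sum_(i <- s | P i) inner (h i) z.
Proof.
by elim/big_rec2: _ => [|i ? ? _ <-]; rewrite ?inner0l ?innerDl.
Qed.

Lemma normD_sqr x y :
  `|x + y| ^+ 2 = `|x| ^+ 2 + 2 * inner x y + `|y| ^+ 2.
Proof. by rewrite -!inner_norm !(innerDl, innerDr) (innerC y x); ring. Qed.

Lemma normB_sqr x y :
  `|x - y| ^+ 2 = `|x| ^+ 2 - 2 * inner x y + `|y| ^+ 2.
Proof. by rewrite normD_sqr innerNr normrN; ring. Qed.

Lemma cauchy_schwarz x y : `|inner x y| <= `|x| * `|y|.
Proof.
have [->|y0] := eqVneq y 0; first by rewrite inner0r !normr0 mulr0.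
rewrite -ler_sqr ?nnegrE ?mulr_ge0// real_normK ?num_real// exprMn.
have ny : 0 < `|y| ^+ 2 by rewrite exprn_gt0 ?normr_gt0.
rewrite -(ler_pM2l ny) -subr_ge0.
have := sqr_ge0 `| `|y| ^+ 2 *: x - inner x y *: y|.
rewrite normB_sqr !innerZl !innerZr !normrZ !exprMn.
rewrite ger0_norm ?sqr_ge0// real_normK ?num_real//.
by lra.
Qed.

Lemma inner_le x y : inner x y <= `|x| * `|y|.
Proof. exact: le_trans (ler_norm _) (cauchy_schwarz x y). Qed.

Lemma inner_eq0 x : (forall v, inner v x = 0) -> x = 0.
Proof.
move=> /(_ x); rewrite inner_norm => /eqP.
by rewrite expf_eq0/= normr_eq0 => /eqP.
Qed.

Lemma inner_inj x y : (forall v, inner v x = inner v y) -> x = y.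
Proof.
move=> xy; apply/eqP; rewrite -subr_eq0; apply/eqP/inner_eq0 => v.
by rewrite innerBr xy subrr.
Qed.

Lemma cvg_innerl {T} (F : set_system T) {FF : Filter F} (u : T -> X) x v :
  u @ F --> x -> inner (u t) v @[t --> F] --> inner x v.
Proof.
move=> ux; apply/cvgrPdist_lt => e e0.
have v0 : 0 < `|v| + 1 by rewrite ltr_wpDl.
move/cvgrPdist_lt : ux => /(_ (e / (`|v| + 1))); rewrite divr_gt0// => /(_ isT).
apply: filterS => t; rewrite ltr_pdivlMr// => xut.
rewrite -innerBl; apply: le_lt_trans xut.
by apply: le_trans (cauchy_schwarz _ _) _; rewrite ler_wpM2l// lerDl.
Qed.

(* On a closed subspace the functional [v |-> |v|^2 / 2 - l v] attains its
   infimum: by the parallelogram identity minimising sequences are Cauchy. *)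
Lemma riesz_subspace (U : set X) (l : X -> R) (C : R) :
  closed U -> U 0 -> (forall a x y, U x -> U y -> U (a *: x + y)) ->
  (forall a x y, l (a *: x + y) = a * l x + l y) ->
  (forall v, `|l v| <= C * `|v|) ->
  exists2 w, U w & forall v, U v -> l v = inner w v.
Proof.
move=> Ucl U0 Ulin llin lC.
pose J v := `|v| ^+ 2 / 2 - l v.
have J_ge v : - (C ^+ 2 / 2) <= J v.
  have := ler_norm (l v); have := lC v; rewrite /J.
  by have := sqr_ge0 (`|v| - C); rewrite sqrrB; lra.
pose S := [set J v | v in U].
have Sinf : has_inf S.
  by split; [exists (J 0); exists 0|exists (- (C ^+ 2 / 2)) => _ [v _ <-]].
have /choice[u uP] n : exists v, U v /\ J v < inf S + n.+1%:R^-1.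
  have n0 : 0 < n.+1%:R^-1 :> R by rewrite invr_gt0.
  have [_ [v Uv <-] Jv] := inf_adherent n0 Sinf.
  by exists v.
have JS v : U v -> inf S <= J v by move=> Uv; apply: ge_inf; [case: Sinf|exists v].
have JE x y : J ((2^-1 : R) *: (x + y)) =
    (J x + J y) / 2 - `|x - y| ^+ 2 / 8.
  rewrite /J normrZ exprMn ger0_norm// normB_sqr normD_sqr.
  have -> : l (2^-1 *: (x + y)) = (l x + l y) / 2.
    have l0 : l 0 = 0 by have := llin 1 0 0; rewrite scale1r addr0; lra.
    rewrite -[_ *: _]addr0 llin -{1}[x]scale1r llin l0; lra.
  by field.
have Ucauchy : cauchy (u @ \oo).
  apply: cauchy_exP => e e0.
  have e20 : 0 < e ^+ 2 / 8 by rewrite divr_gt0// exprn_gt0.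
  near \oo => N; exists (u N).
  suff : \forall n \near \oo, ball (u N) e (u n) by [].
  near=> n.
  rewrite /= -ball_normE /= -ltr_sqr ?nnegrE ?normr_ge0 ?ltW//.
  have hN : N.+1%:R^-1 < e ^+ 2 / 8 by near: N; exact: near_infty_natSinv_lt (PosNum e20).
  have hn : n.+1%:R^-1 < e ^+ 2 / 8 by near: n; exact: near_infty_natSinv_lt (PosNum e20).
  have [[UN JN] [Un Jn]] := (uP N, uP n).
  have := JS (2^-1 *: (u N + u n)); rewrite JE.
  have H : U (2^-1 *: (u N + u n)).
    rewrite -[X in U X]addr0; apply: (Ulin) => //.
    by rewrite -[u N]scale1r; exact: Ulin.
  move=> /(_ H); move: JN Jn hN hn.
  by move: N.+1%:R^-1 n.+1%:R^-1 => a b; lra.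
have /cvg_ex[w uw] : cvg (u @ \oo) by exact/cauchy_cvgP.
exists w; first by apply: closed_cvg uw => //; apply: nearW => n; case: (uP n).
move=> v Uv.
(* First variation of [J] at [w] in the direction [v], obtained as a limit along the points [u n],
   whose values are within [1 / (n + 1)] of the infimum. *)
have key t : 0 <= t * (inner w v - l v) + t ^+ 2 * (`|v| ^+ 2 / 2).
  have cv : (t * (inner (u n) v - l v) + t ^+ 2 * (`|v| ^+ 2 / 2)
      + n.+1%:R^-1) @[n --> \oo] -->
      t * (inner w v - l v) + t ^+ 2 * (`|v| ^+ 2 / 2) + 0.
    apply: cvgD; last exact: cvg_harmonic.
    apply: cvgD; last exact: cvg_cst.
    apply: cvgMr; apply: cvgB; last exact: cvg_cst.
    exact: cvg_innerl.
  rewrite -[X in _ <= X]addr0; apply: (cvgr_to_ge cv); apply: nearW => n.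
  have [Un Jn] := uP n.
  have := JS (t *: v + u n) (Ulin _ _ _ Uv Un).
  rewrite /J normD_sqr llin innerZl normrZ exprMn real_normK ?num_real//.
  by rewrite (innerC v); move: Jn; rewrite /J; move: n.+1%:R^-1 => a; lra.
set d := inner w v - l v in key.
apply/eqP; rewrite eq_sym -subr_eq0 -/d; apply/eqP.
(* With [t = - d / q], [key] reads [0 <= - (d / q)^2]: the 1 added to [|v|^2 / 2] is the surplus
   that forces [d = 0], also when [v = 0]. *)
pose q := `|v| ^+ 2 / 2 + 1.
have q0 : 0 < q by rewrite ltr_wpDl// divr_ge0// sqr_ge0.
have := key (- (d / q)).
have : (d / q) ^+ 2 * (`|v| ^+ 2 / 2) <= (d / q) ^+ 2 * q - (d / q) ^+ 2.
  by rewrite /q; lra.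
have -> : (d / q) ^+ 2 * q = d / q * d by field; rewrite gt_eqF.
rewrite sqrrN => h1 h2.
have : (d / q) ^+ 2 <= 0 by lra.
have := sqr_ge0 (d / q) => h3 h4.
have : (d / q) ^+ 2 = 0 by lra.
move/eqP; rewrite expf_eq0/= mulf_eq0 invr_eq0 (gt_eqF q0) orbF => /eqP; lra.
Unshelve. all: by end_near. Qed.

Lemma riesz (l : X -> R) (C : R) :
  (forall a x y, l (a *: x + y) = a * l x + l y) ->
  (forall v, `|l v| <= C * `|v|) ->
  exists w, forall v, l v = inner w v.
Proof.
move=> llin lC.
have [||//|//|//|w _ lw] := @riesz_subspace setT l C; [exact: closedT|by []|].
by exists w => v; exact: lw.
Qed.

(** Representing [inner x] on [U] by an element [w] of [U] gives the orthogonal projection of [x].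
    Then [x - w] is orthogonal to [U], hence lies in [U] by the last hypothesis. *)
Lemma subspace_orthogonal (U : set X) :
  closed U -> U 0 -> (forall a x y, U x -> U y -> U (a *: x + y)) ->
  (forall v, (forall u, U u -> inner v u = 0) -> U v) -> U = setT.
Proof.
move=> Ucl U0 Ulin Uorth; apply/seteqP; split=> // x _.
have [||w Uw xw] := @riesz_subspace U (inner x) `|x| Ucl U0 Ulin.
- by move=> a y z; rewrite innerDr innerZr.
- by move=> v; exact: cauchy_schwarz.
rewrite -[x](subrK w) -[x - w]scale1r; apply: Ulin => //.
by apply: Uorth => u Uu; rewrite innerBl xw// subrr.
Qed.

End Inner_product.

(** * Weak sequential compactness of bounded sets *)

Lemma ultra_cvg_compact {T} {V : topologicalType} (G : set_system T)
    (GU : UltraFilter G) (K : set V) (u : T -> V) :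
  compact K -> (forall t, K (u t)) -> exists2 p, K p & u @ G --> p.
Proof.
move=> cK Ku; have Gp := @ultra_proper _ _ GU.
have [p [Kp clp]] : K `&` cluster (u @ G) !=set0.
  have uGK : G (u @^-1` K) by apply: filterE => t; exact: Ku.
  exact: cK uGK.
exists p => // B Bp; have [//|GB] := in_ultra_setVsetC (u @^-1` B) GU.
by have [q [nBq Bq]] := clp (~` B) B GB Bp; case: (nBq Bq).
Qed.

Lemma continuous_linear_normP {R : realType} {V W : normedModType R}
    (h : {linear V -> W}) :
  continuous h -> exists2 C : R, 0 <= C & forall v, `|h v| <= C * `|v|.
Proof.
move=> /linear_bounded_continuous/linear_boundedP hb.
by near (pinfty_nbhs R) => C; exists C => //; near: C.
Unshelve. all: by end_near. Qed.

Section Weak_convergence.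
Context {R : realType} {X Y : hilbertType R}.

Lemma grad_spec (f : X -> R) x : differentiable f x ->
  forall v, 'd f x v = inner (grad f x) v.
Proof.
move=> df; have [C _ dC] := continuous_linear_normP (diff_continuous df).
have [||w dw] := @riesz _ _ ('d f x) C.
- by move=> a u v; rewrite linearP.
- by [].
rewrite /grad; case: xgetP => [w' -> //|] /(_ w); case; move=> v; exact: dw.
Qed.

Lemma adjoint_spec (T : X -> Y) (C : R) :
  (forall a u v, T (a *: u + v) = a *: T u + T v) ->
  (forall v, `|T v| <= C * `|v|) ->
  forall y v, inner (T v) y = inner v (adjoint T y).
Proof.
move=> Tlin TC y; have [||w dw] := @riesz _ _ (fun v => inner (T v) y) (C * `|y|).
- by move=> a u v; rewrite Tlin innerDl innerZl.
- move=> v; apply: le_trans (cauchy_schwarz _ _) _.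
  by rewrite mulrAC ler_wpM2r.
rewrite /adjoint; case: xgetP => [w' -> //|] /(_ w); case => v.
by rewrite dw innerC.
Qed.

(* When [x] is not in the range of [T T*], the choice operator in [adjoint] may
   return junk; the right inverse property excludes this. *)
Lemma adjoint_right_inverse_spec (T : {linear X -> Y}) :
  (forall y, T (adjoint T y) = y) ->
  forall y v, inner (T v) y = inner v (adjoint T y).
Proof.
move=> TT y v; have [->|y0] := eqVneq y 0.
  rewrite inner0r /adjoint; case: xgetP => [w _ <-|_]; rewrite ?inner0r//.
move: v; have /eqP := TT y; rewrite /adjoint.
case: xgetP => [w _ //|_]; by rewrite linear0 eq_sym (negbTE y0).
Qed.

(** An ultrafilter [G] finer than [\oo] yields at once the limit of [A x] and of all
    [inner (x n) v]; the latter limit is a bounded functional of [v], represented by [p], and the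
    adjoint identifies the former as [A p]. The rest replaces [G] by a sequence of indices.
    Monotonicity of [s] is not demanded; [n <= s n] suffices for limits. *)
Lemma bounded_weakly_cvg_subseq (A : {linear X -> Y}) (As : Y -> X)
    (x : nat -> X) (B : set X) :
  (forall v y, inner (A v) y = inner v (As y)) -> compact_operator A ->
  bounded_set B -> (forall n, B (x n)) ->
  exists (s : nat -> nat) (p : X), [/\ forall n, (n <= s n)%N,
    weakly_cvg (x \o s) p & A (x (s n)) @[n --> \oo] --> A p].
Proof.
move=> AAs Acomp Bb Bx.
have [M M0 xM] : exists2 M, 0 <= M & forall n, `|x n| <= M.
  by have [M M0 BM] := pinfty_ex_gt0 Bb; exists M => [|n]; [exact: ltW|exact: BM].
have [G [GU oG]] := ultraFilterLemma (eventually_filter : ProperFilter \oo).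
have Gp := @ultra_proper _ _ GU.
have [y _ Ay] : exists2 y, closure (A @` B) y & (A \o x) @ G --> y.
  apply: ultra_cvg_compact; first by rewrite -precompactE; exact: Acomp.
  by move=> n; apply: subset_closure; exists (x n).
have /choice[l lP] v : exists a : R, inner (x n) v @[n --> G] --> a.
  have [|n|a _ xa] := @ultra_cvg_compact _ _ G GU
    `[- (M * `|v|), M * `|v|]%classic (fun n => inner (x n) v).
  - exact: segment_compact.
  - rewrite /= in_itv/= -ler_norml; apply: le_trans (cauchy_schwarz _ _) _.
    by rewrite ler_wpM2r.
  - by exists a.
have [||p pP] := @riesz _ _ l M.
- move=> a u v; apply: (norm_cvg_unique (lP _)).
  have -> : (fun n => inner (x n) (a *: u + v)) =
      (fun n => a * inner (x n) u + inner (x n) v).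
    by apply/funext => n; rewrite innerDr innerZr.
  by apply: cvgD => //; apply: cvgMr.
- move=> v; rewrite ler_norml; apply/andP; split.
    apply: (cvgr_to_ge (lP v)); apply: nearW => n.
    have := cauchy_schwarz (x n) v; rewrite ler_norml => /andP[+ _].
    by apply: le_trans; rewrite lerN2 ler_wpM2r.
  apply: (cvgr_to_le (lP v)); apply: nearW => n.
  by apply: le_trans (inner_le _ _) _; rewrite ler_wpM2r.
have xp v : inner (x n) v @[n --> G] --> inner p v by rewrite -pP.
have yE : y = A p.
  apply: inner_inj => z; rewrite !(innerC z) (AAs p).
  apply: (norm_cvg_unique _ (xp (As z))).
  have -> : (fun n => inner (x n) (As z)) = (fun n => inner ((A \o x) n) z).
    by apply/funext => n; rewrite -AAs.
  exact: cvg_innerl.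
(* [s n] approximates the limits along [G] against the first [n] vectors [x i], so that each fixed
   [x i] is tested from some index on. *)
have /choice[s sP] n : exists k, [/\ (n <= k)%N, `|A p - A (x k)| < n.+1%:R^-1 &
    forall i : 'I_n, `|inner p (x i) - inner (x k) (x i)| < n.+1%:R^-1].
  have n0 : 0 < n.+1%:R^-1 :> R by rewrite invr_gt0.
  near G => k; exists k; split.
  - by near: k; apply: oG; exists n.
  - by near: k; rewrite -yE; apply: cvgr_dist_lt.
  - by near: k; apply: filter_forall => i; apply: cvgr_dist_lt.
exists s, p; split; first by move=> n; case: (sP n).
  (* [U] is a closed subspace containing every [x i]. A vector orthogonal to [U] is orthogonal to
     all [x i] and, in the limit, to [p], so it lies in [U] trivially; hence [U] is everything. *)
  pose U := [set v | inner (x (s n) - p) v @[n --> \oo] --> (0 : R)].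
  suff UT : U = setT.
    move=> xi cxi; have [C _ xiC] := continuous_linear_normP cxi.
    have [||w xiw] := @riesz _ _ xi C; [by move=> a u v; rewrite linearP|by []|].
    have : U w by rewrite UT.
    move=> /= Uw; rewrite xiw; under eq_fun do rewrite xiw innerC.
    rewrite innerC -[inner p w]add0r.
    apply: cvg_trans (cvgD Uw (cvg_cst (inner p w))).
    apply: near_eq_cvg; apply: nearW => n /=.
    by rewrite fctE/= innerBl subrK.
  have sb n : `|x (s n) - p| <= M + `|p|.
    by apply: le_trans (ler_normB _ _) _; rewrite lerD2r.
  apply: subspace_orthogonal.
  - move=> v vU; apply/cvgr0Pnorm_lt => e e0.
    have d0 : 0 < e / 2 / (M + `|p| + 1) by rewrite !divr_gt0// ltr_wpDl// addr_ge0.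
    have [w [Uw /=]] := vU _ (nbhsx_ballx v (e / 2 / (M + `|p| + 1)) d0).
    rewrite -ball_normE/= ltr_pdivlMr ?ltr_wpDl ?addr_ge0// => vw.
    have /cvgr0Pnorm_lt/(_ (e / 2)) := Uw; rewrite divr_gt0// => /(_ isT).
    apply: filterS => n nw.
    rewrite -[v](subrK w) innerDr [e]splitr.
    apply: le_lt_trans (ler_normD _ _) _; apply: ler_ltD => //.
    apply: le_trans (cauchy_schwarz _ _) _.
    have := sb n; have := normr_ge0 (v - w); nra.
  - by rewrite /U/=; under eq_fun do rewrite inner0r; exact: cvg_cst.
  - move=> a u v Uu Uv; rewrite /U/=; under eq_fun do rewrite innerDr innerZr.
    have -> : 0 = a * 0 + 0 :> R by rewrite mulr0 addr0.
    by apply: cvgD => //; apply: cvgMr.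
  - move=> v vU.
    have Ux i : U (x i).
      apply/cvgr0Pnorm_lt => e e0; near=> n.
      have ni : (i < n)%N by near: n; exists i.+1.
      have [_ _ /(_ (Ordinal ni))/=] := sP n.
      rewrite distrC -innerBl => /lt_trans; apply.
      by near: n; exact: near_infty_natSinv_lt (PosNum e0).
    have pv : inner p v = 0.
      apply: (norm_cvg_unique (xp v)).
      have -> : (fun n => inner (x n) v) = cst 0.
        by apply/funext => n; rewrite innerC vU.
      exact: cvg_cst.
    apply: (_ : (fun n => inner (x (s n) - p) v) @ \oo --> (0 : R)).
    have -> : (fun n => inner (x (s n) - p) v) = cst 0.
      by apply/funext => n; rewrite innerBl pv innerC vU ?subrr.
    exact: cvg_cst.
apply/cvgrPdist_lt => e e0; near=> n.
have [_ /lt_trans + _] := sP n; apply.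
by near: n; exact: near_infty_natSinv_lt (PosNum e0).
Unshelve. all: by end_near. Qed.

End Weak_convergence.

(** * The Hilbert space of multipliers *)

Section Euclidean_rows.
Context {R : realType} {m : nat}.
Implicit Types u v w : 'rV[R]_m.

Lemma dotvC u v : dotv u v = dotv v u.
Proof. by apply: eq_bigr => i _; rewrite mulrC. Qed.

Lemma dotv_linearl a u v w : dotv (a *: u + v) w = a * dotv u w + dotv v w.
Proof.
rewrite /dotv mulr_sumr -big_split/=; apply: eq_bigr => i _.
by rewrite !mxE mulrDl mulrA.
Qed.

Lemma dotv_ge0 u : 0 <= dotv u u.
Proof. by apply: sumr_ge0 => i _; rewrite -expr2 sqr_ge0. Qed.

Lemma enorm_sqr u : enorm u ^+ 2 = dotv u u.
Proof. by rewrite sqr_sqrtr// dotv_ge0. Qed.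

Lemma enorm_sqrE u : enorm u ^+ 2 = \sum_i u 0 i ^+ 2.
Proof. by rewrite enorm_sqr; apply: eq_bigr => i _; rewrite expr2. Qed.

Lemma sqr_coord_le u i : u 0 i ^+ 2 <= enorm u ^+ 2.
Proof.
rewrite enorm_sqrE (bigD1 i)//= lerDl; apply: sumr_ge0 => j _; exact: sqr_ge0.
Qed.

Lemma enorm_eq0 u : enorm u ^+ 2 <= 0 -> u = 0.
Proof.
move=> u0; apply/rowP => i; apply/eqP; rewrite mxE -sqrf_eq0 eq_le sqr_ge0 andbT.
exact: le_trans (sqr_coord_le u i) u0.
Qed.

End Euclidean_rows.

(* The library norm on a pair is the maximum norm; [hprod] carries the Hilbert norm. *)
Definition hprod {R : realType} (H : hilbertType R) (m : nat) : Type :=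
  (H * 'rV[R]_m)%type.

Section Hilbert_product.
Context {R : realType} (H : hilbertType R) (m : nat).

HB.instance Definition _ := GRing.Lmodule.copy (hprod H m) (H * 'rV[R]_m)%type.

Definition hprod_inner (z w : hprod H m) : R := inner z.1 w.1 + dotv z.2 w.2.

Definition hprod_norm (z : hprod H m) : R := Num.sqrt (hprod_inner z z).

Lemma hprod_innerC z w : hprod_inner z w = hprod_inner w z.
Proof. by rewrite /hprod_inner innerC dotvC. Qed.

Lemma hprod_inner_linearl a x y z :
  hprod_inner (a *: x + y) z = a * hprod_inner x z + hprod_inner y z.
Proof. by rewrite /hprod_inner inner_linearl dotv_linearl/=; ring. Qed.

Lemma hprod_inner_ge0 z : 0 <= hprod_inner z z.
Proof. by rewrite addr_ge0 ?dotv_ge0// inner_norm sqr_ge0. Qed.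

Lemma hprod_norm_sqr z : hprod_norm z ^+ 2 = hprod_inner z z.
Proof. by rewrite sqr_sqrtr// hprod_inner_ge0. Qed.

Lemma hprod_norm_ge0 z : 0 <= hprod_norm z.
Proof. exact: sqrtr_ge0. Qed.

Lemma hprod_norm_eq0 z : hprod_norm z = 0 -> z = 0.
Proof.
move=> z0; have := hprod_norm_sqr z; rewrite z0 expr0n/= => /esym/eqP.
rewrite /hprod_inner inner_norm -enorm_sqr paddr_eq0 ?sqr_ge0//.
rewrite sqrf_eq0 normr_eq0 => /andP[/eqP z1 /eqP z2].
by rewrite [z]surjective_pairing z1 (@enorm_eq0 _ _ z.2) ?z2.
Qed.

Lemma hprod_inner0l z : hprod_inner 0 z = 0.
Proof.
rewrite /hprod_inner inner0l add0r /dotv big1// => i _.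
by rewrite mxE mul0r.
Qed.

Lemma hprod_inner_comb a b z w :
  hprod_inner (a *: z + b *: w) (a *: z + b *: w) =
  a ^+ 2 * hprod_norm z ^+ 2 + 2 * a * b * hprod_inner z w
    + b ^+ 2 * hprod_norm w ^+ 2.
Proof.
have Zl c x y : hprod_inner (c *: x) y = c * hprod_inner x y.
  by rewrite -[c *: x]addr0 hprod_inner_linearl hprod_inner0l addr0.
rewrite hprod_inner_linearl !hprod_norm_sqr Zl.
rewrite !(hprod_innerC _ (a *: z + b *: w)) !hprod_inner_linearl !Zl.
by rewrite (hprod_innerC w z); ring.
Qed.

Lemma hprod_inner_le z w : hprod_inner z w <= hprod_norm z * hprod_norm w.
Proof.
have [/eqP z0|z0] := boolP (hprod_norm z == 0).
  by rewrite (hprod_norm_eq0 z0) hprod_inner0l mulr_ge0 ?hprod_norm_ge0.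
have [/eqP w0|w0] := boolP (hprod_norm w == 0).
  by rewrite (hprod_norm_eq0 w0) hprod_innerC hprod_inner0l mulr_ge0 ?hprod_norm_ge0.
have zw : 0 < hprod_norm z * hprod_norm w.
  by rewrite mulr_gt0// lt_neqAle hprod_norm_ge0 eq_sym ?z0 ?w0.
rewrite -(ler_pM2l zw).
have := hprod_inner_ge0 (hprod_norm w *: z + (- hprod_norm z) *: w).
rewrite hprod_inner_comb; lra.
Qed.

Lemma hprod_normD z w : hprod_norm (z + w) <= hprod_norm z + hprod_norm w.
Proof.
rewrite -ler_sqr ?nnegrE ?addr_ge0 ?hprod_norm_ge0// hprod_norm_sqr.
have := hprod_inner_comb 1 1 z w; rewrite !scale1r => ->.
by rewrite sqrrD; have := hprod_inner_le z w; lra.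
Qed.

Lemma hprod_normZ a z : hprod_norm (a *: z) = `|a| * hprod_norm z.
Proof.
apply/eqP; rewrite -(@eqrXn2 _ 2) ?mulr_ge0 ?hprod_norm_ge0//.
rewrite exprMn !hprod_norm_sqr real_normK ?num_real//.
rewrite /hprod_inner innerZl innerZr.
have -> : dotv (a *: z).2 (a *: z).2 = a ^+ 2 * dotv z.2 z.2.
  by rewrite /dotv mulr_sumr; apply: eq_bigr => i _; rewrite !mxE; ring.
by apply/eqP; ring.
Qed.

HB.instance Definition _ :=
  Lmodule_isNormed.Build R (hprod H m) hprod_normD hprod_normZ hprod_norm_eq0.

(** There are [m + 1] components, and the square root of [m + 1] is at most [m + 1]. *)
Lemma hprod_norm_le (z : hprod H m) (c : R) :
  `|z.1| <= c -> (forall i, `|z.2 0 i| <= c) -> `|z| <= m.+1%:R * c.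
Proof.
move=> z1 z2; have c0 : 0 <= c by apply: le_trans z1.
rewrite -ler_sqr ?nnegrE ?mulr_ge0// hprod_norm_sqr /hprod_inner.
rewrite inner_norm -enorm_sqr enorm_sqrE.
have h1 : `|z.1| ^+ 2 <= c ^+ 2 by rewrite ler_sqr ?nnegrE.
have h2 : \sum_i z.2 0 i ^+ 2 <= \sum_(i < m) c ^+ 2.
  apply: ler_sum => i _; rewrite -(@real_normK _ (z.2 0 i)) ?num_real//.
  by rewrite ler_sqr ?nnegrE.
apply: le_trans (lerD h1 h2) _.
rewrite sumr_const card_ord -mulrS -[leLHS]mulr_natl exprMn.
by rewrite ler_wpM2r ?sqr_ge0// expr2 ler_pMl ?ltr0n// ler1n.
Qed.

Lemma hprod_fst_le (z : hprod H m) : `|z.1| <= `|z|.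
Proof.
rewrite -ler_sqr ?nnegrE// hprod_norm_sqr /hprod_inner inner_norm lerDl.
exact: dotv_ge0.
Qed.

Lemma hprod_snd_le (z : hprod H m) i : `|z.2 0 i| <= `|z|.
Proof.
rewrite -ler_sqr ?nnegrE// hprod_norm_sqr /hprod_inner real_normK ?num_real//.
rewrite -enorm_sqr inner_norm; apply: le_trans (sqr_coord_le _ i) _.
by rewrite lerDr sqr_ge0.
Qed.

Lemma hprod_complete (F : set_system (hprod H m)) :
  ProperFilter F -> cauchy F -> cvg F.
Proof.
move=> FF /cauchyP Fc.
have fstc : cauchy (fst @ F).
  apply: cauchy_exP => e /Fc[z Fz]; exists z.1.
  suff : F [set w | ball z.1 e w.1] by [].
  apply: filterS Fz => w /=; rewrite -!ball_normE/=; apply: le_lt_trans.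
  exact: hprod_fst_le (z - w).
have sndc i : cauchy ((fun z : hprod H m => z.2 0 i : R) @ F).
  apply: cauchy_exP => e /Fc[z Fz]; exists (z.2 0 i).
  suff : F [set w : hprod H m | ball (z.2 0 i) e (w.2 0 i)] by [].
  apply: filterS Fz => w /=; rewrite -!ball_normE/=; apply: le_lt_trans.
  by have := hprod_snd_le (z - w) i; rewrite !mxE.
have /cvg_ex[l Fl] : cvg (fst @ F) by exact/cauchy_cvgP.
have /choice[a Fa] i : exists a : R, (fun z : hprod H m => z.2 0 i : R) @ F --> a.
  by have /cvg_ex : cvg ((fun z : hprod H m => z.2 0 i : R) @ F) by exact/cauchy_cvgP.
apply/cvg_ex; exists ((l, \row_i a i) : hprod H m); apply/cvgrPdist_le => e e0.
pose d := e / m.+1%:R.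
have d0 : 0 < d by rewrite divr_gt0.
have F1 : F [set z : hprod H m | `|l - z.1| <= d] by apply: cvgr_dist_le.
have F2 : F [set z : hprod H m | forall i, `|a i - z.2 0 i| <= d].
  by apply: filter_forall => i; apply: cvgr_dist_le => //; exact: Fa.
near=> z.
have -> : e = m.+1%:R * d by rewrite mulrC divfK// pnatr_eq0.
apply: hprod_norm_le; first by near: z.
by move=> i; rewrite !mxE; move: i; near: z; exact: F2.
Unshelve. all: by end_near. Qed.

HB.instance Definition _ := Uniform_isComplete.Build (hprod H m) hprod_complete.

HB.instance Definition _ := CompleteNormedModule_isHilbert.Build R (hprod H m)
  hprod_innerC hprod_inner_linearl (fun z => esym (hprod_norm_sqr z)).

Lemma hprod_innerE (z w : hprod H m) :
  inner z w = inner z.1 w.1 + dotv z.2 w.2.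
Proof. by []. Qed.

Lemma hprod_normE (z : hprod H m) : `|z| ^+ 2 = `|z.1| ^+ 2 + enorm z.2 ^+ 2.
Proof. by rewrite -inner_norm hprod_innerE inner_norm enorm_sqr. Qed.

End Hilbert_product.

(** * Mean value estimates *)

Section Mean_value.
Context {R : realType} {V W : normedModType R}.

Lemma diff_remainder (f : V -> W) x : differentiable f x ->
  forall e : R, 0 < e -> \forall y \near x,
    `|f y - f x - 'd f x (y - x)| <= e * `|y - x|.
Proof.
case=> -[_ /eqaddoP + e e0] => /(_ e e0); rewrite lim_id// => fE.
by apply: filterS fE => y /=; rewrite !fctE/= opprD addrA.
Qed.

Lemma is_derive_remainder (k : R -> R) (t d : R) :
  (forall e : R, 0 < e -> \forall s \near t,
    `|k s - k t - (s - t) * d| <= e * `|s - t|) ->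
  is_derive t 1 k d.
Proof.
move=> kd.
have H : (fun h => h^-1 *: ((k \o shift t) (h *: 1) - k t)) @ 0^' --> d.
  apply/cvgrPdist_le => e e0.
  have /nbhs0P := kd _ e0; move=> /nbhs_dnbhs; apply: filter_app; near=> h => /=.
  have h0 : h != 0 by near: h; exact: nbhs_dnbhs_neq.
  rewrite [t + h]addrC addrK /GRing.scale/= mulr1 => kh.
  have hp : 0 < `|h| by rewrite normr_gt0.
  rewrite -(ler_pM2r hp) -normrM; apply: le_trans kh.
  rewrite distrC le_eqVlt; apply/orP; left; apply/eqP; congr (`| _ |).
  by field.
apply: DeriveDef; first exact: cvgP H.
exact: cvg_lim H.
Unshelve. all: by end_near. Qed.

Section line.
Variables (xi : W -> R) (C : R).
Hypothesis xi_lin : forall a x y, xi (a *: x + y) = a * xi x + xi y.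
Hypothesis xi_bounded : forall w, `|xi w| <= C * `|w|.

Lemma is_derive_line (h : V -> W) (dh : V -> W) (x u : V) (t : R) :
  (forall a, dh (a *: u) = a *: dh u) ->
  (forall e : R, 0 < e -> \forall y \near (x + t *: u),
    `|h y - h (x + t *: u) - dh (y - (x + t *: u))| <= e * `|y - (x + t *: u)|) ->
  is_derive t 1 (fun s => xi (h (x + s *: u))) (xi (dh u)).
Proof.
move=> dhZ hd; apply: is_derive_remainder => e e0.
have xi0 : xi 0 = 0 by have := xi_lin 1 0 0; rewrite scale1r addr0; lra.
have xiN w : xi (- w) = - xi w.
  by have := xi_lin (- 1) w 0; rewrite addr0 scaleN1r xi0; lra.
have xiZ a w : xi (a *: w) = a * xi w by rewrite -[a *: w]addr0 xi_lin xi0 addr0.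
have xiD w w' : xi (w + w') = xi w + xi w' by rewrite -[in LHS](scale1r w) xi_lin mul1r.
pose q := (`|C| + 1) * (`|u| + 1).
have q0 : 0 < q by rewrite mulr_gt0// ltr_wpDl.
have cl : (fun s : R => x + s *: u) @ t --> x + t *: u.
  by apply: cvgD; [exact: cvg_cst|apply: cvgZl; exact: cvg_id].
have eq0 : 0 < e / q by rewrite divr_gt0.
apply: filterS (cl _ (hd _ eq0) : nbhs t _) => s /=.
have -> : x + s *: u - (x + t *: u) = (s - t) *: u.
  by rewrite scalerBl opprD addrACA subrr add0r.
rewrite dhZ -xiZ -!xiN -!xiD => hs.
apply: le_trans (xi_bounded _) _.
apply: le_trans (ler_wpM2r (normr_ge0 _) (ler_norm C)) _.
apply: le_trans (ler_wpM2l (normr_ge0 C) hs) _.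
have CuS : `|C| * `|u| <= q by rewrite /q ler_pM// lerDl.
rewrite normrZ [leLHS](_ : _ = (e / q * `|s - t|) * (`|C| * `|u|)); last by ring.
have -> : e * `|s - t| = (e / q * `|s - t|) * q by field; rewrite gt_eqF.
by rewrite ler_wpM2l// mulr_ge0// ltW.
Qed.

(** Composing with a functional [xi] reduces to the one-variable theorem. The derivative [dh] is a
    parameter so that the same statement serves [f] itself and [y |-> 'd f y v], whose derivative is
    given by [d2 f]. *)
Lemma mean_value_line (h : V -> W) (dh : V -> V -> W) (x u : V) :
  (forall y a, dh y (a *: u) = a *: dh y u) ->
  (forall y (e : R), 0 < e -> \forall z \near y,
    `|h z - h y - dh y (z - y)| <= e * `|z - y|) ->
  exists2 s : R, 0 <= s <= 1 & xi (h (x + u)) - xi (h x) = xi (dh (x + s *: u) u).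
Proof.
move=> dhZ hd.
pose k (s : R) : R := xi (h (x + s *: u)).
have kd (t : R) : is_derive t 1 k (xi (dh (x + t *: u) u)).
  by apply: (@is_derive_line h (dh (x + t *: u))) => [a|e e0]; [exact: dhZ|exact: hd].
have [|s s01 ks] := @MVT_segment R k (fun t => xi (dh (x + t *: u) u)) 0 1 ler01 (fun t _ => kd t).
  apply: continuous_subspaceT => t; apply/differentiable_continuous.
  by apply/derivable1_diffP; case: (kd t).
exists s; first by move: s01; rewrite in_itv.
by move: ks; rewrite /k scale1r scale0r addr0 subr0 mulr1.
Qed.

Lemma mean_value (f : V -> W) x u : (forall x, differentiable f x) ->
  exists2 s : R, 0 <= s <= 1 & xi (f (x + u)) - xi (f x) = xi ('d f (x + s *: u) u).
Proof.
move=> df; apply: (mean_value_line (dh := fun y => 'd f y)).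
  by move=> y a; rewrite linearZ.
by move=> y; exact: diff_remainder.
Qed.

Lemma mean_value2 (f : V -> W) x u v : C2 f ->
  exists2 s : R, 0 <= s <= 1 &
    xi ('d f (x + u) v) - xi ('d f x v) = xi (d2 f (x + s *: u) u v).
Proof.
case=> _ f2 _.
apply: (mean_value_line (h := fun y => 'd f y v) (dh := fun y h => d2 f y h v)).
  move=> y a; case: (f2 y) => _ /(_ v) lin _ _; have l0 : d2 f y 0 v = 0.
      by apply: (addrI (d2 f y 0 v)); have := lin 1 0 0; rewrite /= !scale1r !addr0 => <-.
    by have := lin a u 0; rewrite /= addr0 l0 addr0.
move=> y e e0; case: (f2 y) => _ _ _ /(_ (e / (`|v| + 1))).
rewrite divr_gt0 ?ltr_wpDl// => /(_ isT); apply: filterS => z /(_ v).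
move=> /le_trans; apply; rewrite mulrAC ler_wpM2r//.
by rewrite mulrAC ler_pdivrMr ?ltr_wpDl// ler_wpM2l ?(ltW e0)// lerDl.
Qed.

End line.
End Mean_value.
(* The Hahn-Banach property that lets the scalar mean value theorem bound the
   increments of a map with values in [W]. *)
Definition norming {R : realType} (W : normedModType R) : Prop :=
  forall w0 : W, exists xi : W -> R,
    [/\ forall a x y, xi (a *: x + y) = a * xi x + xi y,
        forall w, `|xi w| <= 1 * `|w| & xi w0 = `|w0|].

Lemma norming_real (R : realType) : norming (R : normedModType R).
Proof.
move=> w0; exists (fun w => Num.sg w0 * w); split.
- by move=> a x y; rewrite mulrDr mulrCA.
- move=> w; rewrite normrM ler_wpM2r//.
  by rewrite normr_sg; case: (w0 != 0).
- by rewrite -normrEsg.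
Qed.

(** [xi] is the pairing with [w0 / |w0|]; for [w0 = 0] the convention [0^-1 = 0] makes it the zero
    functional. *)
Lemma norming_hilbert (R : realType) (W : hilbertType R) : norming W.
Proof.
move=> w0; exists (fun w => `|w0|^-1 * inner w w0); split.
- by move=> a x y; rewrite inner_linearl; ring.
- move=> w; rewrite normrM normfV normr_id.
  have [->|w00] := eqVneq w0 0.
    by rewrite inner0r !normr0 mulr0 mul1r.
  rewrite ler_pdivrMl ?normr_gt0// mul1r mulrC; exact: cauchy_schwarz.
- have [->|w00] := eqVneq w0 0; first by rewrite normr0 inner0r mulr0.
  by rewrite inner_norm expr2 mulKf// normr_eq0.
Qed.

(** The third clause linearises at [y] the increment between two other points, a quantitative strict
    differentiability; it makes the nonlinear part of the equation in [local_geometry] Lipschitz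
    with a small constant. [df] is a parameter because the derivative of [Phi] is assembled by
    components. *)
Definition C2_bounds {R : realType} {V W : normedModType R} (f : V -> W)
    (df : V -> V -> W) (y0 : V) (L d : R) : Prop :=
  [/\ forall y v, `|y - y0| <= d -> `|df y v| <= L * `|v|,
      forall y y' v, `|y - y0| <= d -> `|y' - y0| <= d ->
        `|df y v - df y' v| <= L * `|y - y'| * `|v| &
      forall y y1 y2 s, `|y - y0| <= d -> `|y1 - y0| <= d -> `|y2 - y0| <= d ->
        `|y1 - y| <= s -> `|y2 - y| <= s ->
        `|f y1 - f y2 - df y (y1 - y2)| <= L * s * `|y1 - y2|].

Section Mean_value_norm.
Context {R : realType} {V W : normedModType R}.
Hypothesis W_norming : norming W.

Lemma norm_mean_value (f : V -> W) x u w K : (forall x, differentiable f x) ->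
  (forall s : R, 0 <= s <= 1 -> `|'d f (x + s *: u) u - w| <= K) ->
  `|f (x + u) - f x - w| <= K.
Proof.
move=> df dfK; have [xi [xil xib <-]] := W_norming (f (x + u) - f x - w).
have [s s01 fs] := mean_value xil xib x u df.
have xiB a b : xi (a - b) = xi a - xi b.
  by rewrite -[in LHS](scale1r a) xil; have := xil (- 1) b (- b + b);
    rewrite addNr scaleN1r addr0 mulN1r => ->; have := xil 1 0 0;
    rewrite scale1r addr0; lra.
rewrite !xiB fs -xiB; apply: le_trans (ler_norm _) _.
by apply: le_trans (xib _) _; rewrite mul1r dfK.
Qed.

Lemma norm_mean_value2 (f : V -> W) x u v K : C2 f ->
  (forall s : R, 0 <= s <= 1 -> `|d2 f (x + s *: u) u v| <= K) ->
  `|'d f (x + u) v - 'd f x v| <= K.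
Proof.
move=> f2 fK; have [xi [xil xib <-]] := W_norming ('d f (x + u) v - 'd f x v).
have [s s01 fs] := mean_value2 xil xib x u v f2.
have xiB a b : xi (a - b) = xi a - xi b.
  by rewrite -[in LHS](scale1r a) xil; have := xil (- 1) b (- b + b);
    rewrite addNr scaleN1r addr0 mulN1r => ->; have := xil 1 0 0;
    rewrite scale1r addr0; lra.
rewrite xiB fs; apply: le_trans (ler_norm _) _.
by apply: le_trans (xib _) _; rewrite mul1r fK.
Qed.

Lemma norm_segment (x y z : V) (s d : R) : 0 <= s <= 1 ->
  `|x - z| <= d -> `|y - z| <= d -> `|x + s *: (y - x) - z| <= d.
Proof.
move=> /andP[s0 s1] xz yz.
have -> : x + s *: (y - x) - z = (1 - s) *: (x - z) + s *: (y - z).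
  rewrite addrAC scalerBl scale1r -[RHS]addrA -scalerN -scalerDr; congr (_ + _ *: _).
  by rewrite opprB [RHS]addrC addrA subrK.
apply: le_trans (ler_normD _ _) _; rewrite !normrZ ger0_norm ?subr_ge0//.
rewrite (ger0_norm s0); nra.
Qed.

(** Near [y0] the first and second derivatives differ from those at [y0] by at most 1 in operator
    norm; the mean value theorem on the convex ball then gives the Lipschitz clauses. The form with
    all large [L] and all small [d] lets finitely many maps share the same constants. *)
Lemma C2_bounds_near (f : V -> W) y0 : C2 f ->
  \forall L \near +oo, \forall d \near 0^'+, C2_bounds f (fun y v => 'd f y v) y0 L d.
Proof.
move=> f2; have [[fd f1] f2d f2c] := f2.
have [_ _ [M2 M2P] _] := f2d y0.
have [M1 M10 M1P] := continuous_linear_normP (diff_continuous (fd y0)).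
have /nbhs_closedballP[e1 e1P] := f1 y0 1 ltr01.
have /nbhs_closedballP[e2 e2P] := f2c y0 1 ltr01.
near=> L; near=> d.
have e1d : d <= e1%:num by near: d; apply: nbhs_right_le.
have e2d : d <= e2%:num by near: d; apply: nbhs_right_le.
have d0 : 0 < d by near: d; exact: nbhs_right_gt.
have M1L : M1 + 1 <= L by near: L; apply: nbhs_pinfty_ge; rewrite num_real.
have M2L : M2 + 1 <= L by near: L; apply: nbhs_pinfty_ge; rewrite num_real.
have L0 : 0 <= L by apply: le_trans M1L; rewrite addr_ge0.
have ballP (e : {posnum R}) y : d <= e%:num -> `|y - y0| <= d -> closed_ball y0 e%:num y.
  by move=> de yd; rewrite closed_ballE// /closed_ball_/= distrC (le_trans yd).
have d2L y h v : `|y - y0| <= d -> `|d2 f y h v| <= L * `|h| * `|v|.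
  move=> yd; have := e2P _ (ballP _ _ e2d yd) h v.
  have := M2P h v; have := ler_normD (d2 f y h v - d2 f y0 h v) (d2 f y0 h v).
  rewrite subrK.
  have hv : 0 <= `|h| * `|v| by rewrite mulr_ge0.
  have : (M2 + 1) * (`|h| * `|v|) <= L * (`|h| * `|v|) by rewrite ler_wpM2r.
  by rewrite mulrDl !mul1r !mulrA; lra.
have dLip y y' v : `|y - y0| <= d -> `|y' - y0| <= d ->
    `|'d f y v - 'd f y' v| <= L * `|y - y'| * `|v|.
  move=> yd y'd; rewrite -[y in 'd f y](subrK y') [_ + y']addrC.
  apply: norm_mean_value2 => // s s01; apply: d2L; exact: norm_segment.
split=> //.
- move=> y v yd; have := e1P _ (ballP _ _ e1d yd) v; have := M1P v.
  have := ler_normD ('d f y v - 'd f y0 v) ('d f y0 v); rewrite subrK.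
  have : (M1 + 1) * `|v| <= L * `|v| by rewrite ler_wpM2r.
  by rewrite mulrDl !mul1r; lra.
- move=> y y1 y2 s yd y1d y2d y1s y2s.
  have {1}-> : y1 = y2 + (y1 - y2) by rewrite addrC subrK.
  apply: norm_mean_value => // t t01.
  apply: le_trans (dLip _ _ _ _ yd) _; first exact: norm_segment.
  rewrite ler_wpM2r// ler_wpM2l//; exact: norm_segment.
Unshelve. all: by end_near. Qed.

End Mean_value_norm.
(** * The constraint map near an optimal point *)

Lemma contraction_solve {R : realType} {K : completeNormedModType R}
    (P : K -> K) (rho q : R) :
  0 <= rho -> 0 <= q < 1 ->
  (forall z z', `|z| <= rho -> `|z'| <= rho -> `|P z - P z'| <= q * `|z - z'|) ->
  `|P 0| <= (1 - q) * rho ->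
  exists2 z, `|z| <= rho & P z = z.
Proof.
move=> rho0 /andP[q0 q1] Pq P0.
pose U := [set z : K | `|z| <= rho].
have PU : {homo P : z / U z}.
  move=> z Uz; rewrite /U/= -[P z](subrK (P 0)).
  apply: le_trans (ler_normD _ _) _.
  have := Pq z 0 Uz; rewrite normr0 subr0 => /(_ rho0).
  have : q * `|z| <= q * rho by rewrite ler_wpM2l.
  by lra.
pose Pf : {fun U >-> U} := mkfun PU.
have [|||z Uz zE] := @banach_fixed_point R K U Pf.
- exists (NngNum q0); split => //= -[z z'] [Uz Uz'].
  exact: Pq.
- have -> : U = Num.norm @^-1` [set x | x <= rho] by [].
  apply: closed_comp; last exact: closed_le.
  by move=> z _; exact: norm_continuous.
- by exists 0; rewrite /U/= normr0.
by exists z => //; rewrite [RHS]zE.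
Qed.

(** A solution is a fixed point of [z - s (N z - tau)]. With [s = a / M^2] its squared Lipschitz
    constant is at most [1 - 2 a s + s^2 M^2 = 1 - a s], which is below [(1 - a s / 2)^2]; [a <= M]
    ensures [a s <= 1]. The bound on [tau] says exactly that the ball is mapped into itself. *)
Lemma strongly_monotone_solve {R : realType} {K : hilbertType R}
    (N : K -> K) (a M rho : R) (tau : K) :
  0 < a -> a <= M -> 0 <= rho -> N 0 = 0 ->
  (forall z z', `|z| <= rho -> `|z'| <= rho ->
    a * `|z - z'| ^+ 2 <= inner (N z - N z') (z - z')) ->
  (forall z z', `|z| <= rho -> `|z'| <= rho ->
    `|N z - N z'| <= M * `|z - z'|) ->
  `|tau| <= a * rho / 2 ->
  exists2 z, `|z| <= rho & N z = tau.
Proof.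
move=> a0 aM rho0 N0 Nmon Nlip taub.
have M0 : 0 < M by apply: lt_le_trans aM.
pose s := a / M ^+ 2; pose q := 1 - a * s / 2.
have s0 : 0 < s by rewrite divr_gt0// exprn_gt0.
have sM : s * M ^+ 2 = a by rewrite /s divfK// gt_eqF// exprn_gt0.
have as1 : a * s <= 1.
  by rewrite /s mulrA ler_pdivrMr ?exprn_gt0// mul1r -expr2 ler_sqr ?nnegrE// ltW.
have as0 : 0 < a * s by rewrite mulr_gt0.
have q01 : 0 <= q < 1 by rewrite /q; apply/andP; split; lra.
have [||z zr Pz] := @contraction_solve R K (fun z => z - s *: (N z - tau)) rho q rho0 q01.
- move=> z z' zr z'r.
  have -> : z - s *: (N z - tau) - (z' - s *: (N z' - tau)) =
      (z - z') - s *: (N z - N z').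
    rewrite opprD opprK addrACA; congr (_ + _).
    by rewrite [LHS]addrC -scalerBr -scalerN !opprB addrA subrK.
  case/andP: (q01) => q0 _.
  rewrite -ler_sqr ?nnegrE ?mulr_ge0// normB_sqr innerZr innerC normrZ.
  have h1 := Nmon _ _ zr z'r; have h2 := Nlip _ _ zr z'r.
  have {}h2 : `|N z - N z'| ^+ 2 <= M ^+ 2 * `|z - z'| ^+ 2.
    by rewrite -exprMn ler_sqr ?nnegrE// mulr_ge0// ltW.
  rewrite (ger0_norm (ltW s0)) [(s * _) ^+ 2]exprMn [(q * _) ^+ 2]exprMn.
  have h3 := ler_wpM2l (ltW s0) h1.
  have h4 : s ^+ 2 * `|N z - N z'| ^+ 2 <= a * s * `|z - z'| ^+ 2.
    rewrite -sM; apply: le_trans (ler_wpM2l (sqr_ge0 s) h2) _.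
    by rewrite le_eqVlt; apply/orP; left; apply/eqP; ring.
  have h5 : (1 - a * s) * `|z - z'| ^+ 2 <= q ^+ 2 * `|z - z'| ^+ 2.
    rewrite ler_wpM2r ?sqr_ge0//.
    have -> : q ^+ 2 = 1 - a * s + (a * s / 2) ^+ 2 by rewrite /q; field.
    by rewrite lerDl sqr_ge0.
  by move: h3 h4 h5; lra.
- rewrite N0 !sub0r scalerN opprK normrZ (ger0_norm (ltW s0)).
  rewrite /q; have := ler_wpM2l (ltW s0) taub; lra.
exists z => //; apply/eqP; rewrite -subr_eq0.
have /eqP : - (s *: (N z - tau)) = 0 by apply: (addrI z); rewrite Pz addr0.
by rewrite oppr_eq0 scaler_eq0 (gt_eqF s0).
Qed.
Section Constraint_map.
Context {R : realType} {Y H : hilbertType R} {m : nat}.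
Variables (F0 : Y -> H) (g0 : 'I_m -> Y -> R).
Hypotheses (F0_C2 : C2 F0) (g0_C2 : forall i, C2 (g0 i)).
Implicit Types (y v : Y) (nu z : hprod H m).

Definition Phi y : hprod H m := (F0 y, \row_i g0 i y).

(* [dPhi y] is the derivative of [Phi] at [y]. *)
Definition dPhi y v : hprod H m := ('d F0 y v, \row_i 'd (g0 i) y v).

Definition dPhiT y nu : Y := adjoint (dPhi y) nu.

(** With [d i = g0 i y ^+ 2] this is the operator D of the overview; the component in [H] is zero
    because equality constraints carry no weight. *)
Definition weigh (d : 'I_m -> R) nu : hprod H m := (0, \row_i (d i * nu.2 0 i)).

Definition active (y : Y) i : bool := g0 i y == 0.

(* [weigh (inactive_sqr y0 y)] is the operator D' of the header. *)
Definition inactive_sqr (y0 y : Y) i : R := if active y0 i then 0 else g0 i y ^+ 2.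

Lemma F0_diff y : differentiable F0 y. Proof. by case: F0_C2 => -[]. Qed.

Lemma g0_diff i y : differentiable (g0 i) y.
Proof. by case: (g0_C2 i) => -[]. Qed.

Lemma dPhi_lin y a u v : dPhi y (a *: u + v) = a *: dPhi y u + dPhi y v.
Proof.
rewrite /dPhi linearP; congr pair; apply/rowP => i.
by rewrite !mxE linearP.
Qed.

Lemma dPhiB y u v : dPhi y (u - v) = dPhi y u - dPhi y v.
Proof. by rewrite addrC -scaleN1r dPhi_lin scaleN1r addrC. Qed.

Lemma C2_bounds_Phi y0 : \forall L \near +oo, \forall d \near 0^'+,
  C2_bounds Phi dPhi y0 L d.
Proof.
have HF := C2_bounds_near (@norming_hilbert R H) y0 F0_C2.
have Hg : \forall L \near +oo, \forall d \near 0^'+,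
    forall i, C2_bounds (g0 i) (fun y v => 'd (g0 i) y v) y0 L d.
  have : \forall L \near +oo, forall i, \forall d \near 0^'+,
      C2_bounds (g0 i) (fun y v => 'd (g0 i) y v) y0 L d.
    by apply: filter_forall => i; apply: C2_bounds_near => //; exact: norming_real.
  by apply: filterS => L HL; exact: filter_forall.
have [L0 L00 {HF Hg} [HF Hg]] := pinfty_ex_gt0 (filterI HF Hg).
have L0d : \forall d \near 0^'+, C2_bounds Phi dPhi y0 (m.+1%:R * L0) d.
  move: HF Hg; apply: filterS2 => d [F1 F2 F3] Hg; split.
  - move=> y v yd; rewrite -mulrA; apply: hprod_norm_le; first exact: F1.
    by move=> i; rewrite mxE; case: (Hg i) => + _ _; exact.
  - move=> y y' v yd y'd; rewrite -2!mulrA; apply: hprod_norm_le.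
      by rewrite mulrA; exact: F2.
    by move=> i; rewrite !mxE mulrA; case: (Hg i) => _ + _; exact.
  - move=> y y1 y2 s yd y1d y2d y1s y2s; rewrite -2!mulrA.
    apply: hprod_norm_le; first by rewrite mulrA; exact: F3.
    by move=> i; rewrite !mxE mulrA; case: (Hg i) => _ _; exact.
near=> L.
have LL : m.+1%:R * L0 <= L by near: L; apply: nbhs_pinfty_ge; rewrite num_real.
apply: filterS L0d => d [H1 H2 H3]; split.
- by move=> y v yd; apply: le_trans (H1 _ _ yd) _; rewrite ler_wpM2r.
- move=> y y' v yd y'd; apply: le_trans (H2 _ _ _ yd y'd) _.
  by rewrite ler_wpM2r// ler_wpM2r.
- move=> y y1 y2 s yd y1d y2d y1s y2s; apply: le_trans (H3 _ _ _ s _ _ _ _ _) _ => //.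
  by rewrite ler_wpM2r// ler_wpM2r//; apply: le_trans y1s.
Unshelve. all: by end_near. Qed.

Lemma dPhi_bounded y : exists C : R, forall v, `|dPhi y v| <= C * `|v|.
Proof.
have [L _ /(filterI (nbhs_right_gt 0))/filter_ex[d [d0 [dL _ _]]]] :=
  pinfty_ex_gt0 (C2_bounds_Phi y).
by exists L => v; apply: dL; rewrite subrr normr0 ltW.
Qed.

Lemma dPhiT_spec y v nu : inner (dPhi y v) nu = inner v (dPhiT y nu).
Proof.
by have [C dC] := dPhi_bounded y; exact: adjoint_spec (dPhi_lin y) dC _ _.
Qed.

Lemma dPhiT_lin y a nu z : dPhiT y (a *: nu + z) = a *: dPhiT y nu + dPhiT y z.
Proof.
by apply: inner_inj => v; rewrite innerDr innerZr -!dPhiT_spec innerDr innerZr.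
Qed.

Lemma dPhiTB y nu z : dPhiT y (nu - z) = dPhiT y nu - dPhiT y z.
Proof. by rewrite addrC -scaleN1r dPhiT_lin scaleN1r addrC. Qed.

Lemma dPhiT0 y : dPhiT y 0 = 0.
Proof. by have := dPhiTB y 0 0; rewrite !subrr. Qed.

Lemma dPhiT_le y nu L : 0 <= L -> (forall v, `|dPhi y v| <= L * `|v|) ->
  `|dPhiT y nu| <= L * `|nu|.
Proof.
move=> L0 dL; have [->|w0] := eqVneq (dPhiT y nu) 0.
  by rewrite normr0 mulr_ge0.
have wp : 0 < `|dPhiT y nu| by rewrite normr_gt0.
rewrite -(ler_pM2l wp) -expr2 -inner_norm -dPhiT_spec.
apply: le_trans (inner_le _ _) _.
by rewrite [leRHS]mulrCA [leRHS]mulrA ler_wpM2r.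
Qed.

Lemma dPhiT_E y nu : dPhiT y nu =
  adjoint ('d F0 y) nu.1 + \sum_i nu.2 0 i *: grad (g0 i) y.
Proof.
apply: inner_inj => v; rewrite -dPhiT_spec innerDr [inner v (\sum__ _)]innerC inner_suml.
have [C _ dC] := continuous_linear_normP (diff_continuous (F0_diff y)).
rewrite -(adjoint_spec (T := 'd F0 y) (C := C))//; last first.
  by move=> a u w; rewrite linearP.
congr (_ + _); apply: eq_bigr => i _.
by rewrite mxE innerZl mulrC grad_spec//; exact: g0_diff.
Qed.

Lemma inner_weigh d nu z :
  inner (weigh d nu) z = \sum_i d i * nu.2 0 i * z.2 0 i.
Proof.
rewrite hprod_innerE inner0l add0r.
by apply: eq_bigr => i _; rewrite mxE.
Qed.

Lemma weighB d nu z : weigh d (nu - z) = weigh d nu - weigh d z.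
Proof.
have -> : weigh d nu - weigh d z = (0 - 0, (weigh d nu).2 - (weigh d z).2) by [].
rewrite /weigh; congr pair; first by rewrite subr0.
by apply/rowP => i; rewrite !mxE mulrBr.
Qed.

Lemma weigh0 d : weigh d 0 = 0.
Proof. by have := weighB d 0 0; rewrite !subrr. Qed.

Lemma weigh_le d nu C : 0 <= C -> (forall i, `|d i| <= C) ->
  `|weigh d nu| <= m.+1%:R * (C * `|nu|).
Proof.
move=> C0 dC; apply: hprod_norm_le; first by rewrite normr0 mulr_ge0.
by move=> i; rewrite mxE normrM ler_pM// hprod_snd_le.
Qed.

Lemma Q0E y nu :
  Q0 F0 g0 y nu.1 nu.2 =
  2^-1 * `|dPhi y (dPhiT y nu) + weigh (fun i => g0 i y ^+ 2) nu| ^+ 2.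
Proof.
rewrite /Q0 -dPhiT_E hprod_normE /= addr0 mulrDr; congr (_ + _ * enorm _ ^+ 2).
apply/rowP => i; rewrite mul_mx_diag !mxE grad_spec; last exact: g0_diff.
by rewrite mulrC.
Qed.

End Constraint_map.

(** * Uniform coercivity and solvability near a reference point *)

Section Local_geometry.
Context {R : realType} {Y H : hilbertType R} {m : nat}.
Variables (F0 : Y -> H) (g0 : 'I_m -> Y -> R).
Hypotheses (F0_C2 : C2 F0) (g0_C2 : forall i, C2 (g0 i)).
Local Notation Phi := (Phi F0 g0).
Local Notation dPhi := (dPhi F0 g0).
Local Notation dPhiT := (dPhiT F0 g0).

(** [Q0] is half the squared norm of B nu, with B = dPhi dPhi^T + D, whereas the later arguments
    need the quadratic form of B. Both summands of B are nonnegative and bounded by [L ^+ 2], so the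
    squared norm of each image is at most [L ^+ 2] times its own form. *)
Lemma coercive_of_Q0 (y : Y) (a L : R) :
  0 < L -> (forall v, `|dPhi y v| <= L * `|v|) -> (forall i, `|g0 i y| <= L) ->
  (forall nu : hprod H m, a * `|nu| ^+ 2 <= Q0 F0 g0 y nu.1 nu.2) ->
  forall nu : hprod H m, a / L ^+ 2 * `|nu| ^+ 2 <=
    `|dPhiT y nu| ^+ 2 + \sum_i g0 i y ^+ 2 * nu.2 0 i ^+ 2.
Proof.
move=> L0 dL gL aQ nu; set S := \sum_i _.
have L20 : 0 < L ^+ 2 by rewrite exprn_gt0.
rewrite mulrAC ler_pdivrMr// [leRHS]mulrC; apply: le_trans (aQ nu) _; rewrite Q0E//.
set u := dPhi y _; set w := weigh _ _.
have uL : `|u| ^+ 2 <= L ^+ 2 * `|dPhiT y nu| ^+ 2.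
  by rewrite -exprMn ler_sqr ?nnegrE ?mulr_ge0 ?(ltW L0) ?dL.
have wL : `|w| ^+ 2 <= L ^+ 2 * S.
  rewrite -inner_norm inner_weigh mulr_sumr; apply: ler_sum => i _.
  rewrite mxE [leLHS](_ : _ = g0 i y ^+ 2 * (g0 i y ^+ 2 * nu.2 0 i ^+ 2)).
    apply: ler_wpM2r; first by rewrite mulr_ge0 ?sqr_ge0.
    by rewrite -(@real_normK _ (g0 i y)) ?num_real// ler_sqr ?nnegrE// ltW.
  by ring.
have := normD_sqr u w; have := normB_sqr u w; have := sqr_ge0 `|u - w|.
lra.
Qed.

Lemma dPhiT_sub_le (y y' : Y) (c : R) (nu : hprod H m) : 0 <= c ->
  (forall v, `|dPhi y v - dPhi y' v| <= c * `|v|) ->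
  `|dPhiT y nu - dPhiT y' nu| <= c * `|nu|.
Proof.
move=> c0 dc; set w := _ - _; have [->|w0] := eqVneq w 0.
  by rewrite normr0 mulr_ge0.
have wp : 0 < `|w| by rewrite normr_gt0.
rewrite -(ler_pM2l wp) -expr2 -inner_norm.
have -> : inner w w = inner (dPhi y w - dPhi y' w) nu.
  by rewrite [RHS]innerBl !(dPhiT_spec F0_C2 g0_C2) -innerBr.
apply: le_trans (inner_le _ _) _.
by rewrite [leRHS]mulrCA [leRHS]mulrA ler_wpM2r.
Qed.

(** The map [z |-> Phi (y + dPhiT y z) - Phi y + D' z] has the coercive linear part dPhi dPhi^T +
    D', and on a small ball its nonlinear remainder costs at most half of the coercivity constant
    [a], so [strongly_monotone_solve] applies. The radius [e] is quantified after [L] and [a]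
    because its later choice depends on them. *)
Lemma local_geometry (y0 : Y) (a0 : R) : 0 < a0 ->
  (forall nu : hprod H m, a0 * `|nu| ^+ 2 <= Q0 F0 g0 y0 nu.1 nu.2) ->
  exists L a e0 : R, [/\ 0 < L, 0 < a, 0 < e0,
  forall y, `|y - y0| <= e0 -> `|Phi y - Phi y0| <= 2 * L * `|y - y0| &
  forall e, 0 < e -> e <= e0 -> exists d t : R, [/\ 0 < d, d <= e, 0 < t &
  forall y, `|y - y0| <= d ->
  [/\ forall v, `|dPhi y v| <= L * `|v|,
      forall nu : hprod H m, a * `|nu| ^+ 2 <=
        `|dPhiT y nu| ^+ 2 + \sum_i inactive_sqr g0 y0 y i * nu.2 0 i ^+ 2,
      forall tau, `|tau| <= t -> exists z,
        [/\ `|z| <= 4 / a * `|tau|, `|y + dPhiT y z - y0| <= e &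
            Phi (y + dPhiT y z) - Phi y + weigh (inactive_sqr g0 y0 y) z = tau] &
      forall h, `|y + h - y0| <= e ->
        `|Phi (y + h) - Phi y - dPhi y h| <= L * `|h| ^+ 2]]].
Proof.
move=> a00 Q0a.
have gL : \forall L \near +oo, forall i, `|g0 i y0| + 1 <= L.
  by apply: filter_forall => i; apply: nbhs_pinfty_ge; rewrite num_real.
have [L L0 [[CL L1] {}gL]] := pinfty_ex_gt0 (filterI (filterI
  (C2_bounds_Phi F0_C2 g0_C2 y0) (nbhs_pinfty_ge (num_real 1))) gL).
pose a := a0 / L ^+ 2 / 2.
have L20 : 0 < L ^+ 2 by rewrite exprn_gt0.
have a_gt0 : 0 < a by rewrite !divr_gt0.
have [e0 [e00 [[e01 Le0] [Le0' [dL dLip PhiL]]]]] : exists e0, 0 < e0 /\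
    ((e0 <= 1 /\ e0 <= (2 * L)^-1) /\ (e0 <= a / (8 * L ^+ 2) /\ C2_bounds Phi dPhi y0 L e0)).
  near (0 : R)^'+ => e0; exists e0; split; first by near: e0; exact: nbhs_right_gt.
  split; first split; last split.
  - by near: e0; exact: nbhs_right_le.
  - by near: e0; apply: nbhs_right_le; rewrite invr_gt0 mulr_gt0.
  - by near: e0; apply: nbhs_right_le; rewrite divr_gt0// mulr_gt0.
  - by near: e0.
have {}Le0 : 2 * L * e0 <= 1.
  by rewrite -ler_pdivlMl ?mulr_gt0// mulr1.
have {}Le0' : 8 * L ^+ 2 * e0 <= a by rewrite mulrC -ler_pdivlMr// mulr_gt0.
have y0e : `|y0 - y0| <= e0 by rewrite subrr normr0 ltW.
have Phi_near y : `|y - y0| <= e0 -> `|Phi y - Phi y0| <= 2 * L * `|y - y0|.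
  move=> ye; have := PhiL y0 y y0 `|y - y0| y0e ye y0e (lexx _).
  rewrite subrr normr0 => /(_ (normr_ge0 _)).
  have := dL y0 (y - y0) y0e.
  have := ler_normD (Phi y - Phi y0 - dPhi y0 (y - y0)) (dPhi y0 (y - y0)).
  rewrite subrK.
  have : L * `|y - y0| * `|y - y0| <= L * `|y - y0| * 1.
    by apply: ler_wpM2l; [rewrite mulr_ge0 ?(ltW L0)|exact: le_trans e01].
  by clear -F0_C2 g0_C2; lra.
have g_near y i : `|y - y0| <= e0 -> `|g0 i y - g0 i y0| <= 2 * L * e0.
  move=> ye; have := hprod_snd_le (Phi y - Phi y0) i; rewrite !mxE.
  move=> /le_trans; apply; apply: le_trans (Phi_near _ ye) _.
  by rewrite ler_wpM2l// mulr_ge0// ltW.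
have gyL y i : `|y - y0| <= e0 -> `|g0 i y| <= L.
  move=> ye; have := gL i; have := g_near y i ye.
  have := ler_normD (g0 i y - g0 i y0) (g0 i y0); rewrite subrK; move: Le0; clear -F0_C2 g0_C2; lra.
have coer0 := coercive_of_Q0 L0 (fun v => dL y0 v y0e) (fun i => gyL y0 i y0e) Q0a.
(* Budget for moving from [y0] to [y], with [c = L^2 e0]: the change of [dPhiT] costs 3 and that of
   the weights 4. The total 7 fits into [8 L^2 e0 <= a], and [a] is half of the constant [a0 / L^2]
   valid at [y0]. *)
have arith (N T0 T S0 S c : R) : 2 * a * N <= T0 + S0 -> T0 <= T + 3 * c * N ->
    S0 <= S + 4 * c * N -> 7 * c * N <= a * N -> a * N <= T + S.
  by clear -F0_C2 g0_C2; lra.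
have coer y (nu : hprod H m) : `|y - y0| <= e0 -> a * `|nu| ^+ 2 <=
    `|dPhiT y nu| ^+ 2 + \sum_i inactive_sqr g0 y0 y i * nu.2 0 i ^+ 2.
  move=> ye; have := coer0 nu.
  have -> : a0 / L ^+ 2 = 2 * a by rewrite /a [RHS]mulrC divfK.
  have h1 : `|dPhiT y0 nu - dPhiT y nu| <= L * e0 * `|nu|.
    apply: dPhiT_sub_le; first by rewrite mulr_ge0// ltW.
    move=> v; apply: le_trans (dLip _ _ _ y0e ye) _.
    by rewrite distrC ler_wpM2r// ler_wpM2l ?(ltW L0).
  have h2 : `|dPhiT y nu| <= L * `|nu| by apply: dPhiT_le => //; rewrite ?ltW// => v; exact: dL.
  have h3 : `|dPhiT y0 nu| ^+ 2 <= `|dPhiT y nu| ^+ 2 + 3 * (L ^+ 2 * e0) * `|nu| ^+ 2.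
    have : `|dPhiT y0 nu| <= `|dPhiT y nu| + L * e0 * `|nu|.
      have := ler_normD (dPhiT y0 nu - dPhiT y nu) (dPhiT y nu); rewrite subrK.
      by move=> /le_trans; apply; rewrite addrC lerD2l.
    rewrite -ler_sqr ?nnegrE ?addr_ge0 ?mulr_ge0// ?(ltW L0) ?(ltW e00)//.
    move=> /le_trans; apply; rewrite sqrrD -addrA lerD2l.
    have : `|dPhiT y nu| * (L * e0 * `|nu|) <= L * `|nu| * (L * e0 * `|nu|).
      by apply: ler_wpM2r => //; rewrite !mulr_ge0// ltW.
    have : (L * e0 * `|nu|) ^+ 2 <= L ^+ 2 * e0 * `|nu| ^+ 2.
      rewrite !exprMn ler_wpM2r ?sqr_ge0// ler_wpM2l ?(ltW L20)//.
      by rewrite expr2 ler_piMr// ltW.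
    by rewrite -mulr_natl; clear -F0_C2 g0_C2; lra.
  have h4 : \sum_i g0 i y0 ^+ 2 * nu.2 0 i ^+ 2 <=
      \sum_i inactive_sqr g0 y0 y i * nu.2 0 i ^+ 2 + 4 * (L ^+ 2 * e0) * `|nu| ^+ 2.
    have : \sum_i 4 * (L ^+ 2 * e0) * nu.2 0 i ^+ 2 <= 4 * (L ^+ 2 * e0) * `|nu| ^+ 2.
      rewrite -mulr_sumr -enorm_sqrE ler_wpM2l//.
        by rewrite !mulr_ge0// ?(ltW L20) ?ltW.
      by rewrite hprod_normE lerDr sqr_ge0.
    move=> h; apply: le_trans (lerD (lexx _) h); rewrite -big_split/=.
    apply: ler_sum => i _; rewrite -mulrDl ler_wpM2r ?sqr_ge0// /inactive_sqr.
    case: ifPn => [/eqP ->|_]; first by rewrite expr0n add0r !mulr_ge0 ?ltW.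
    rewrite -lerBlDl subr_sqr; apply: le_trans (ler_norm _) _; rewrite normrM.
    have -> : 4 * (L ^+ 2 * e0) = 2 * L * e0 * (L + L) by ring.
    rewrite ler_pM// 1?distrC ?g_near//; apply: le_trans (ler_normD _ _) _.
    by rewrite lerD ?gyL.
  have : 7 * (L ^+ 2 * e0) * `|nu| ^+ 2 <= a * `|nu| ^+ 2.
    rewrite ler_wpM2r ?sqr_ge0//; have : 0 <= L ^+ 2 * e0 by rewrite mulr_ge0// ltW.
    by move: Le0'; clear -F0_C2 g0_C2; lra.
  by move=> h5 h6; exact: arith h6 h3 h4 h5.
exists L, a, e0; split => // e e_gt0 ee0.
(* The first entry keeps [y + dPhiT y z] within [e] of [y0]; the second bounds by [a / 2] the
   Lipschitz constant [L^3 rho] of the remainder. The choice [t = a rho / 4] makes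
   [4 / a * |tau| <= rho]. *)
pose rho := Num.min (e / (2 * L)) (a / (2 * L ^+ 3)).
have L30 : 0 < L ^+ 3 by rewrite exprn_gt0.
have rho0 : 0 < rho by rewrite lt_min !divr_gt0// mulr_gt0.
have rho1 : L * rho <= e / 2.
  rewrite mulrC -ler_pdivlMr//.
  apply: le_trans (_ : e / (2 * L) <= _); first by rewrite ge_min lexx.
  by rewrite invfM mulrA.
have rho2 : L ^+ 3 * rho <= a / 2.
  rewrite mulrC -ler_pdivlMr//.
  apply: le_trans (_ : a / (2 * L ^+ 3) <= _); first by rewrite ge_min lexx orbT.
  by rewrite invfM mulrA.
exists (e / 2), (a * rho / 4); split => //.
- by rewrite divr_gt0.
- by rewrite ler_pdivrMr// ler_peMr ?(ltW e_gt0)// ?ler1n.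
- by rewrite divr_gt0// mulr_gt0.
move=> y ye2.
have ye : `|y - y0| <= e0.
  apply: le_trans ye2 _; apply: le_trans ee0.
  by rewrite ler_pdivrMr// ler_peMr ?(ltW e_gt0)// ?ler1n.
split => //.
- by move=> v; exact: dL.
- by move=> nu; exact: coer.
- move=> tau taut.
  pose N (z : hprod H m) : hprod H m :=
    Phi (y + dPhiT y z) - Phi y + weigh (inactive_sqr g0 y0 y) z.
  have TL z : `|dPhiT y z| <= L * `|z|.
    by apply: dPhiT_le => //; rewrite ?ltW// => v; exact: dL.
  have zrho z : `|z| <= 4 / a * `|tau| -> `|dPhiT y z| <= L * rho.
    move=> zt; apply: le_trans (TL z) _; rewrite ler_wpM2l ?(ltW L0)//.
    apply: le_trans zt _.
    by rewrite mulrAC ler_pdivrMr//; move: taut; clear -F0_C2 g0_C2; lra.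
  have zball z : `|z| <= 4 / a * `|tau| -> `|y + dPhiT y z - y0| <= e.
    move=> /zrho zr; rewrite addrAC; apply: le_trans (ler_normD _ _) _.
    by move: ye2 zr rho1; clear -F0_C2 g0_C2; lra.
  have NE z z' : `|z| <= 4 / a * `|tau| -> `|z'| <= 4 / a * `|tau| ->
      exists2 E, `|E| <= a / 2 * `|z - z'| & N z - N z' =
        E + dPhi y (dPhiT y (z - z')) + weigh (inactive_sqr g0 y0 y) (z - z').
    move=> zt z't.
    exists (Phi (y + dPhiT y z) - Phi (y + dPhiT y z') - dPhi y (dPhiT y (z - z'))).
      have := PhiL y (y + dPhiT y z) (y + dPhiT y z') (L * rho) ye
        (le_trans (zball _ zt) ee0) (le_trans (zball _ z't) ee0).
      rewrite ![y + _ - y]addrAC subrr !add0r => /(_ (zrho _ zt) (zrho _ z't)).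
      have -> : y + dPhiT y z - (y + dPhiT y z') = dPhiT y (z - z').
        by rewrite opprD addrACA subrr add0r dPhiTB.
      move=> /le_trans; apply.
      have : L * (L * rho) * `|dPhiT y (z - z')| <= L * (L * rho) * (L * `|z - z'|).
        by rewrite ler_wpM2l// !mulr_ge0// ltW.
      move=> /le_trans; apply.
      have -> : L * (L * rho) * (L * `|z - z'|) = L ^+ 3 * rho * `|z - z'| by ring.
      by rewrite ler_wpM2r.
    rewrite subrK /N weighB opprD addrACA; congr (_ + _).
    by rewrite opprB addrA subrK.
  (* Solving on the ball whose radius is itself [4 / a * |tau|] gives the linear bound on [z]
     directly: with monotonicity constant [a / 2], the condition on [tau] becomes an equality. *)
  have [|||||||z zt Nz] := @strongly_monotone_solve R (hprod H m) N (a / 2)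
      (a / 2 + (L ^+ 2 + m.+1%:R * L ^+ 2)) (4 / a * `|tau|) tau.
  - by rewrite divr_gt0.
  - by rewrite lerDl addr_ge0 ?mulr_ge0 ?ltW.
  - by rewrite mulr_ge0// divr_ge0// ltW.
  - by rewrite /N dPhiT0// addr0 subrr add0r weigh0.
  - move=> z z' zt z't; have [E Eb ->] := NE _ _ zt z't.
    rewrite !innerDl dPhiT_spec// inner_norm inner_weigh.
    have := coer y (z - z') ye; have := cauchy_schwarz E (z - z').
    rewrite ler_norml => /andP[+ _].
    have : `|E| * `|z - z'| <= a / 2 * `|z - z'| * `|z - z'| by rewrite ler_wpM2r.
    have -> : \sum_i inactive_sqr g0 y0 y i * (z - z').2 0 i * (z - z').2 0 i =
      \sum_i inactive_sqr g0 y0 y i * (z - z').2 0 i ^+ 2.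
      by apply: eq_bigr => i _; rewrite -mulrA -expr2.
    by rewrite -mulrA -expr2; clear -F0_C2 g0_C2; lra.
  - move=> z z' zt z't; have [E Eb ->] := NE _ _ zt z't.
    have h1 := ler_normD (E + dPhi y (dPhiT y (z - z'))) (weigh (inactive_sqr g0 y0 y) (z - z')).
    have h2 := ler_normD E (dPhi y (dPhiT y (z - z'))).
    have h3 := dL y (dPhiT y (z - z')) ye.
    have h4 := ler_wpM2l (ltW L0) (TL (z - z')).
    have : `|weigh (inactive_sqr g0 y0 y) (z - z')| <= m.+1%:R * (L ^+ 2 * `|z - z'|).
      apply: weigh_le => [|i]; first exact: ltW.
      rewrite /inactive_sqr; case: ifP => _; first by rewrite normr0 ltW.
      by rewrite normrX ler_sqr ?nnegrE ?(ltW L0)// gyL.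
    rewrite !mulrDl -[m.+1%:R * _ * _]mulrA [L ^+ 2 * `|_|](_ : _ = L * (L * `|z - z'|));
      last by ring.
    by move: h1 h2 h3 h4 Eb; clear -F0_C2 g0_C2; lra.
  - have -> : a / 2 * (4 / a * `|tau|) / 2 = `|tau| by field; rewrite gt_eqF.
    by [].
  by exists z; split => //; exact: zball.
- move=> h hy; have := PhiL y (y + h) y `|h| ye (le_trans hy ee0) ye.
  rewrite [y + h - y]addrAC subrr add0r normr0 lexx => /(_ isT (normr_ge0 _)).
  by rewrite -mulrA -expr2.
Unshelve. all: by end_near. Qed.

End Local_geometry.
(** * The augmented Lagrangian *)

(** Near 0, [phi] lies above the line of slope [k = phi'(0) / 2]. Convexity and [phi 0 = 0] give
    [phi (a t) <= a phi t], so scaling [t] into that neighbourhood extends the bound to the whole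
    domain. *)
Lemma phi_linear_growth {R : realType} (phi : R -> \bar R) :
  phi_admissible phi ->
  (exists dphi : R -> R,
     C1_within (edom phi) (fun t => fine (phi t)) (fun t h => dphi t * h) /\
     0 < dphi 0) ->
  exists k alpha : R, [/\ 0 < k, 0 < alpha,
    forall t, 0 <= t < alpha -> (phi t < +oo)%E &
    forall t, 0 <= t -> (phi t < +oo)%E -> k * t <= fine (phi t)].
Proof.
move=> [[phi_ge0 phi_cvx phi_mono _] [phi0 _ phi_dom]] [dphi [[dphiP _] dphi0]].
have phi00 : phi 0 = 0%E by apply/phi0.
have phi_fin t : 0 <= t -> (phi t < +oo)%E -> (phi t = (fine (phi t))%:E).
  by move=> t0 tfin; rewrite fineK// ge0_fin_numE// phi_ge0.
have edom0 : edom phi 0 by split => //; rewrite phi00 ltry.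
have d20 : 0 < dphi 0 / 2 by rewrite divr_gt0.
have [e /= e0 eP] := dphiP 0 edom0 _ d20.
exists (dphi 0 / 2).
have [alpha alpha0 alphaP] : exists2 alpha, 0 < alpha &
    forall t, 0 <= t < alpha -> (phi t < +oo)%E.
  case: phi_dom => [[domE _]|[alpha [alpha0 domE _]]].
    exists 1 => // t /andP[t0 _].
    by have : edom phi t by [rewrite domE]; case.
  by exists alpha => // t ta; have : edom phi t by [rewrite domE]; case.
exists alpha; split => // t t0 tfin.
have [->|tn0] := eqVneq t 0; first by rewrite mulr0 phi00.
have tp : 0 < t by rewrite lt_neqAle eq_sym tn0.
pose a := Num.min 1 (e / (2 * t)).
have a0 : 0 < a by rewrite lt_min ltr01 divr_gt0// mulr_gt0.
have a1 : a <= 1 by rewrite ge_min lexx.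
have at0 : 0 <= a * t by rewrite mulr_ge0// ltW.
have ate : a * t < e.
  have : a * t <= e / 2.
    by rewrite -ler_pdivlMr// ge_min invfM mulrA lexx orbT.
  lra.
have cvx := phi_cvx t 0 a t0 (lexx _); rewrite (ltW a0) a1 in cvx.
have {}cvx := cvx isT; rewrite mulr0 addr0 phi00 mule0 adde0 in cvx.
rewrite (phi_fin t)// -EFinM in cvx.
have atfin : (phi (a * t)%R < +oo)%E by apply: le_lt_trans cvx _; rewrite ltry.
rewrite (phi_fin (a * t))// lee_fin in cvx.
have := eP (a * t); rewrite /ball/= sub0r normrN ger0_norm// => /(_ ate).
move=> /(_ (conj at0 atfin)); rewrite phi00 /= !subr0 (ger0_norm at0).
rewrite ler_norml => /andP[h _].
rewrite -(ler_pM2l a0); lra.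
Qed.

(** All coordinates of the origin vanish, so the boundary condition makes the gradient of [psi] at 0
    zero. Hence [psi] drops by at most [|y|] close to 0. *)
Lemma psi_lower_near0 {R : realType} {m : nat} (psi : 'rV[R]_m -> R) :
  psi_admissible psi ->
  exists2 s : R, 0 < s &
    forall y, orthant y -> (forall i, y 0 i < s) -> psi 0 / 2 <= psi y.
Proof.
move=> [_ psi0 _ [dpsi [[psiP _] dpsi0]]].
have orth0 : orthant (0 : 'rV[R]_m) by move=> i; rewrite mxE.
have /nbhs_ballP[e /= e0 eP] := psiP 0 orth0 1 ltr01.
have p20 : 0 < psi 0 / 2 by rewrite divr_gt0.
exists (Num.min e (psi 0 / 2)); first by rewrite lt_min e0.
move=> y yo ys.
have By t : 0 < t -> (forall i, y 0 i < t) -> ball (0 : 'rV[R]_m) t y.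
  by move=> t0 yt; split=> // i j; rewrite !ord1 mxE /ball/= sub0r normrN ger0_norm ?yt.
have ye : ball (0 : 'rV[R]_m) e y.
  by apply: By => // i; apply: lt_le_trans (ys i) _; rewrite ge_min lexx.
have : ball (0 : 'rV[R]_m) (psi 0 / 2) y.
  by apply: By => // i; apply: lt_le_trans (ys i) _; rewrite ge_min lexx orbT.
rewrite -ball_normE/= sub0r normrN => yp.
have := eP y ye yo; rewrite subr0 mul1r.
have -> : dotv (dpsi 0) y = 0.
  by rewrite /dotv big1// => i _; rewrite (dpsi0 0 i)// ?mul0r ?mxE.
rewrite subr0 ler_norml => /andP[h _]; lra.
Qed.

Section Augmented_lagrangian.
Context {R : realType} {X H : hilbertType R} {m : nat}.
Variables (f : X -> R) (F : X -> H) (g : 'I_m -> X -> R).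
Variables (phi : R -> \bar R) (psi : 'rV[R]_m -> R).
Hypothesis psi_adm : psi_admissible psi.
Implicit Types (x : X) (l : H) (mu : 'rV[R]_m) (c : R).

Definition shifted_constraint c x mu : 'rV[R]_m :=
  vmax (gvec g x) (- ((c^-1 * penalty_weight g psi x mu) *: mu)).

Lemma psi0_gt0 : 0 < psi 0. Proof. by case: psi_adm. Qed.

Lemma orthant_vmax u : orthant (vmax u (0 : 'rV[R]_m)).
Proof. by move=> i; rewrite !mxE le_max lexx orbT. Qed.

Lemma penalty_weight_gt0 x mu :
  Omega F g phi psi x -> 0 < penalty_weight g psi x mu.
Proof. by move=> [b0 _]; rewrite divr_gt0// ltr_wpDr// sqr_ge0. Qed.

Lemma penalty_weight_le x mu :
  penalty_weight g psi x mu * (1 + enorm mu ^+ 2) <= psi 0.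
Proof.
have mu0 : 0 < 1 + enorm mu ^+ 2 by rewrite ltr_wpDr// sqr_ge0.
rewrite divfK ?gt_eqF//; case: psi_adm => _ _ + _; apply; exact: orthant_vmax.
Qed.

Lemma penalty_weight_le0 x mu :
  Omega F g phi psi x -> penalty_weight g psi x mu <= psi 0.
Proof.
move=> Ox; have := penalty_weight_le x mu; have := penalty_weight_gt0 mu Ox.
have := sqr_ge0 (enorm mu); nra.
Qed.

Lemma auglag_leP c x l mu (a : R) :
  (augmented_lagrangian f F g phi psi c x l mu <= a%:E)%E ->
  Omega F g phi psi x /\
  f x + inner l (F x) + c / 2 * (1 + `|l| ^+ 2) * fine (phi (`|F x| ^+ 2))
   + dotv mu (shifted_constraint c x mu)
   + c / (2 * penalty_weight g psi x mu) * enorm (shifted_constraint c x mu) ^+ 2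
   + Defs.eta f F g x l mu <= a.
Proof.
rewrite /augmented_lagrangian; case: asboolP => [Ox|_]; last by rewrite leNgt ltry.
by rewrite lee_fin.
Qed.

(* Completing the square in [mu q + c / (2 p) q^2]. *)
Lemma dotv_sqr_ge mu (q : 'rV[R]_m) (c p : R) : 0 < c -> 0 < p ->
  c / (4 * p) * enorm q ^+ 2 - p * enorm mu ^+ 2 / c <=
  dotv mu q + c / (2 * p) * enorm q ^+ 2.
Proof.
move=> c0 p0; rewrite !enorm_sqrE [p * _ / c]mulrAC !mulr_sumr -sumrB /dotv -big_split/=.
apply: ler_sum => i _; rewrite -subr_ge0.
have -> : mu 0 i * q 0 i + c / (2 * p) * q 0 i ^+ 2 -
    (c / (4 * p) * q 0 i ^+ 2 - p / c * mu 0 i ^+ 2) =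
    c / (4 * p) * (q 0 i + 2 * p / c * mu 0 i) ^+ 2.
  by field; rewrite !gt_eqF.
by rewrite mulr_ge0 ?sqr_ge0// divr_ge0 ?mulr_ge0// ltW.
Qed.

(** The multipliers can lower the value by only O(1 / c). The factor [1 + |l|^2] allows completing
    the square in [|l| |F x|], at cost [1 / (2 k c)]; the denominator [1 + |mu|^2] of the weight [p]
    gives [p |mu|^2 <= psi 0], hence cost [psi 0 / c]. The minimum collects the coefficient [k / 2]
    of [|F x|^2] and [1 / (4 p) >= 1 / (4 psi 0)] of [|q|^2]. *)
Lemma auglag_lower (k c : R) x l mu (a : R) : 0 < k -> 0 < c ->
  (forall t, 0 <= t -> (phi t < +oo)%E -> k * t <= fine (phi t)) ->
  (augmented_lagrangian f F g phi psi c x l mu <= a%:E)%E ->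
  f x + Defs.eta f F g x l mu + c * Num.min (k / 2) (4 * psi 0)^-1 *
    (`|F x| ^+ 2 + enorm (shifted_constraint c x mu) ^+ 2) <=
  a + ((2 * k)^-1 + psi 0) / c.
Proof.
move=> k0 c0 kphi /auglag_leP[Ox]; set q := shifted_constraint _ _ _.
set p := penalty_weight _ _ _ _ => AL.
have p0 : 0 < p := penalty_weight_gt0 mu Ox.
have pmu : p * enorm mu ^+ 2 <= psi 0.
  by have := penalty_weight_le x mu; rewrite -/p; lra.
have pb : p <= psi 0 := penalty_weight_le0 mu Ox.
have h1 := dotv_sqr_ge mu q c0 p0.
have h2 : p * enorm mu ^+ 2 / c <= psi 0 / c by rewrite ler_wpM2r// invr_ge0 ltW.
have phiF := kphi _ (sqr_ge0 _) Ox.2.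
set P := fine _ in AL phiF.
have h3 : c / 2 * (1 + `|l| ^+ 2) * (k * `|F x| ^+ 2) <= c / 2 * (1 + `|l| ^+ 2) * P.
  by rewrite ler_wpM2l// mulr_ge0 ?addr_ge0 ?sqr_ge0// divr_ge0// ltW.
have h4 : - (`|l| * `|F x|) <= inner l (F x).
  by have := cauchy_schwarz l (F x); rewrite ler_norml => /andP[].
have h5 : 0 <= c * k / 2 * (`|l| * `|F x|) ^+ 2 - `|l| * `|F x| + (2 * k)^-1 / c.
  have -> : c * k / 2 * (`|l| * `|F x|) ^+ 2 - `|l| * `|F x| + (2 * k)^-1 / c =
      c * k / 2 * (`|l| * `|F x| - (c * k)^-1) ^+ 2.
    by field; rewrite !gt_eqF.
  by rewrite mulr_ge0 ?sqr_ge0// divr_ge0 ?mulr_ge0 ?ltW.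
set k1 := Num.min _ _.
have h6 : c * k1 * `|F x| ^+ 2 <= c * (k / 2) * `|F x| ^+ 2.
  by rewrite ler_wpM2r ?sqr_ge0// ler_wpM2l ?(ltW c0)// ge_min lexx.
have h7 : c * k1 * enorm q ^+ 2 <= c / (4 * p) * enorm q ^+ 2.
  rewrite ler_wpM2r ?sqr_ge0// ler_wpM2l ?(ltW c0)//.
  apply: le_trans (_ : (4 * psi 0)^-1 <= _); first by rewrite ge_min lexx orbT.
  have p40 : 0 < 4 * p by exact: mulr_gt0.
  have psi40 : 0 < 4 * psi 0 by rewrite mulr_gt0// psi0_gt0.
  by rewrite lef_pV2 ?posrE// ler_wpM2l.
clearbody p q P k1; rewrite exprMn in h5; rewrite [_ / c]mulrDl; lra.
Qed.

End Augmented_lagrangian.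

(** * The objective along a segment *)

Section Segments.
Context {R : realType} {X : normedModType R} (f : X -> R).
Let id_lin : forall (a x y : R), a *: x + y = a * x + y. Proof. by []. Qed.
Let id_bounded : forall w : R, `|w| <= 1 * `|w|. Proof. by move=> w; rewrite mul1r. Qed.

(** Two applications of the mean value theorem give the constant [M] instead of the sharp
    [M / 2]. *)
Lemma taylor_upper_bound (x u : X) (M : R) : C2 f -> 0 <= M ->
  (forall s : R, 0 <= s <= 1 -> forall h v, `|d2 f (x + s *: u) h v| <= M * `|h| * `|v|) ->
  f (x + u) <= f x + 'd f x u + M * `|u| ^+ 2.
Proof.
move=> f2 M0 fM; have [[fd _] _ _] := f2.
have [s /andP[s0 s1] fs] := mean_value id_lin id_bounded x u fd.
have [t /andP[t0 t1] ft] := mean_value2 id_lin id_bounded x (s *: u) u f2.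
have ts : 0 <= t * s <= 1 by rewrite mulr_ge0// mulr_ile1.
have := fM _ ts (s *: u) u; rewrite -scalerA -ft ler_norml => /andP[_ h].
have : M * `|s *: u| * `|u| <= M * `|u| ^+ 2.
  rewrite -mulrA ler_wpM2l// normrZ (ger0_norm s0) -mulrA -expr2.
  by rewrite ler_piMl ?sqr_ge0.
by move: fs h; clear; lra.
Qed.

(* First exit: on the segment before the first time [f] reaches the level [b],
   the slope bound holds, so [f] cannot have climbed that far. *)
Lemma stay_below (x u : X) (b e : R) : (forall x, differentiable f x) ->
  (forall s : R, 0 <= s <= 1 -> f (x + s *: u) <= b -> 'd f (x + s *: u) u <= e) ->
  0 <= e -> f x + e < b ->
  forall s : R, 0 <= s <= 1 -> f (x + s *: u) <= b.
Proof.
move=> fd fe e0 fxb s /andP[s0 s1]; rewrite leNgt; apply/negP => bs.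
pose k (t : R) : R := f (x + t *: u).
have kd (t : R) : is_derive t 1 k ('d f (x + t *: u) u).
  apply: (is_derive_line id_lin id_bounded) => [a|]; first by rewrite linearZ.
  by move=> e1 e10; exact: diff_remainder.
have kc : continuous k.
  move=> t; apply/differentiable_continuous/derivable1_diffP.
  by case: (kd t).
pose S := `[0, s]%classic `&` [set t | b <= k t].
have [t0 t0S t0min] : exists2 t0, t0 \in S & forall t, t \in S -> t0 <= t.
  apply: (@compact_EVT_min _ R idfun S).
  - exists s; split; first by rewrite /= in_itv/= s0 lexx.
    by rewrite /= ltW.
  - apply: compact_closedI; first exact: segment_compact.
    have -> : [set t | b <= k t] = k @^-1` [set y | b <= y] by [].
    apply: closed_comp; last exact: closed_ge.
    by move=> t _; exact: kc.
  - by apply: continuous_subspaceT => t; exact: cvg_id.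
have [+ bt0] : S t0 by rewrite inE in t0S.
rewrite /= in_itv/= => /andP[t00 t0s].
have t0p : 0 < t0.
  rewrite lt_neqAle t00 andbT; apply/eqP => t0E.
  by move: bt0; rewrite /= -t0E /k scale0r addr0; move: fxb e0; clear; lra.
have [c] := @MVT R k (fun t => 'd f (x + t *: u) u) 0 t0 t0p (fun t _ => kd t)
  (continuous_subspaceT kc).
rewrite in_itv/= => /andP[c0 ct0] kE.
have kcb : k c <= b.
  rewrite leNgt; apply/negP => bc.
  suff : t0 <= c by rewrite leNgt ct0.
  apply: t0min; rewrite inE; split; last exact: ltW.
  by rewrite /= in_itv/= (ltW c0) (le_trans (ltW ct0)).
have c01 : 0 <= c <= 1 by rewrite (ltW c0) (le_trans (ltW ct0))// (le_trans t0s).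
have := fe c c01 kcb.
have k0 : k 0 = f x by rewrite /k scale0r addr0.
have t01 : t0 <= 1 := le_trans t0s s1.
move=> dc; have : 'd f (x + c *: u) u * t0 <= e * 1.
  apply: le_trans (ler_wpM2r (ltW t0p) dc) _; exact: ler_wpM2l.
by move: kE bt0 fxb; rewrite subr0 k0 => <-; rewrite /= mulr1; clear; lra.
Qed.

End Segments.
(** A first order expansion with the functional [inner w] determines the differential by uniqueness.
    This computes gradients without differentiating sums and products piece by piece. *)
Lemma grad_of_remainder {R : realType} {X : hilbertType R} (k : X -> R) (x w : X) :
  (forall e : R, 0 < e -> \forall y \near x,
    `|k y - k x - inner w (y - x)| <= e * `|y - x|) -> grad k x = w.
Proof.
move=> kw.
have wlin : linear (inner w : X -> R).
  by move=> a u v; rewrite innerDr innerZr.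
pose dk : {linear X -> R} :=
  HB.pack (inner w : X -> R) (GRing.isLinear.Build R X R *:%R (inner w : X -> R) wlin).
have dk_cont : continuous dk.
  apply/linear_bounded_continuous/linear_boundedP.
  near=> r; move=> v; apply: le_trans (cauchy_schwarz _ _) _.
  by rewrite ler_wpM2r//; near: r; apply: nbhs_pinfty_ge; rewrite num_real.
have kE : k \o shift x = cst (k x) + dk +o_ (0 : X) id.
  apply/eqaddoP => e e0; have /nbhs0P := kw _ e0.
  apply: filterS => h /=; rewrite !fctE/= [x + h]addrC addrK.
  by rewrite opprD addrA.
have dE : 'd k x = dk :> (X -> R) by exact: diff_unique.
have kd : differentiable k x.
  by apply/diff_locallyP; rewrite dE.
by apply: inner_inj => v; rewrite innerC -grad_spec// dE innerC.
Unshelve. all: by end_near. Qed.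

(** * Gradients and [eta] in terms of [A x] *)

Section Factored_problem.
Context {R : realType} {X H Y : hilbertType R} {m : nat}.
Variables (f : X -> R) (F : X -> H) (g : 'I_m -> X -> R).
Variables (A : {linear X -> Y}) (F0 : Y -> H) (g0 : 'I_m -> Y -> R).
Hypotheses (F_factor : forall x, F x = F0 (A x))
  (g_factor : forall i x, g i x = g0 i (A x))
  (f_diff : forall x, differentiable f x)
  (F0_C2 : C2 F0) (g0_C2 : forall i, C2 (g0 i))
  (AAstar : forall y, A (adjoint A y) = y).
Local Notation Phi := (Phi F0 g0).
Local Notation dPhi := (dPhi F0 g0).
Local Notation dPhiT := (dPhiT F0 g0).

Lemma norm_adjointA y : `|adjoint A y| = `|y|.
Proof.
apply/eqP; rewrite -(@eqrXn2 _ 2)// -!inner_norm.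
by rewrite -(adjoint_right_inverse_spec AAstar) AAstar.
Qed.

Lemma normA_le x : `|A x| <= `|x|.
Proof.
have [->|y0] := eqVneq (A x) 0; first by rewrite normr0.
have yp : 0 < `|A x| by rewrite normr_gt0.
rewrite -(ler_pM2l yp) -expr2 -inner_norm (adjoint_right_inverse_spec AAstar).
by apply: le_trans (inner_le _ _) _; rewrite norm_adjointA mulrC.
Qed.

Lemma A_continuous : continuous A.
Proof.
apply/linear_bounded_continuous/linear_boundedP.
near=> r => v; apply: le_trans (normA_le v) _.
by rewrite ler_peMl//; near: r; apply: nbhs_pinfty_ge; rewrite num_real.
Unshelve. all: by end_near. Qed.

Lemma diff_factor (W : normedModType R) (k : X -> W) (k0 : Y -> W) x v :
  (forall z, k z = k0 (A z)) -> differentiable k0 (A x) ->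
  differentiable k x /\ 'd k x v = 'd k0 (A x) (A v).
Proof.
move=> kE k0d; have -> : k = k0 \o A by apply/funext => z; rewrite kE.
have Ad : differentiable A x by apply: linear_differentiable; exact: A_continuous.
split; first exact: differentiable_comp.
by rewrite diff_comp//= diff_lin//; exact: A_continuous.
Qed.

Lemma grad_lagrangianE x (nu : hprod H m) :
  grad_lagrangian f F g x nu.1 nu.2 = grad f x + adjoint A (dPhiT (A x) nu).
Proof.
have [L _ /(filterI (nbhs_right_gt 0))/filter_ex[d [d0 [_ _ PhiL]]]] :=
  pinfty_ex_gt0 (C2_bounds_Phi F0_C2 g0_C2 (A x)).
apply: grad_of_remainder => e e0.
have e20 : 0 < e / 2 by rewrite divr_gt0.
have lagE z : lagrangian f F g z nu.1 nu.2 = f z + inner nu (Phi (A z)).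
  rewrite /lagrangian hprod_innerE F_factor addrA; congr (_ + _).
  by apply: eq_bigr => i _; rewrite !mxE g_factor.
have q0 : 0 < `|nu| * `|L| + 1 by rewrite ltr_wpDl// mulr_ge0.
near=> z; rewrite !lagE innerDl.
have fz : `|f z - f x - inner (grad f x) (z - x)| <= e / 2 * `|z - x|.
  by rewrite -grad_spec//; near: z; exact: diff_remainder.
(* The remainder of [Phi] is quadratic; the second radius makes its pairing with [nu] at most
   [e / 2 * |z - x|], the other half of [e] being spent on [f]. *)
have zx : `|z - x| <= Num.min d (e / 2 / (`|nu| * `|L| + 1)).
  by rewrite distrC; near: z; apply: cvgr_dist_le => //; rewrite lt_min d0 divr_gt0.
have Azx : `|A z - A x| <= `|z - x| by rewrite -linearB normA_le.
have zd : `|A z - A x| <= d.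
  by apply: le_trans Azx _; apply: le_trans zx _; rewrite ge_min lexx.
have Phiz : `|Phi (A z) - Phi (A x) - dPhi (A x) (A z - A x)| <=
    L * `|A z - A x| * `|A z - A x|.
  by apply: PhiL; rewrite ?subrr ?normr0 ?(ltW d0).
have -> : f z + inner nu (Phi (A z)) - (f x + inner nu (Phi (A x))) -
    (inner (grad f x) (z - x) + inner (adjoint A (dPhiT (A x) nu)) (z - x)) =
    (f z - f x - inner (grad f x) (z - x)) +
    inner nu (Phi (A z) - Phi (A x) - dPhi (A x) (A z - A x)).
  rewrite !(innerBr _ _ nu) [inner nu (dPhi _ _)]innerC dPhiT_spec// -linearB.
  by rewrite (adjoint_right_inverse_spec AAstar) [inner (z - x) _]innerC; ring.
apply: le_trans (ler_normD _ _) _; rewrite [e]splitr mulrDl; apply: lerD => //.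
apply: le_trans (cauchy_schwarz _ _) _.
apply: le_trans (ler_wpM2l (normr_ge0 _) Phiz) _.
have LL : L * `|A z - A x| * `|A z - A x| <= `|L| * `|z - x| * `|z - x|.
  have LA : L * `|A z - A x| <= `|L| * `|z - x|.
    apply: le_trans (ler_wpM2r (normr_ge0 _) (ler_norm L)) _.
    exact: ler_wpM2l.
  apply: le_trans (ler_wpM2r (normr_ge0 _) LA) _.
  by apply: ler_wpM2l => //; rewrite mulr_ge0.
apply: le_trans (ler_wpM2l (normr_ge0 _) LL) _.
rewrite !mulrA ler_wpM2r//.
have : `|z - x| <= e / 2 / (`|nu| * `|L| + 1).
  by apply: le_trans zx _; rewrite ge_min lexx orbT.
rewrite ler_pdivlMr// => h; apply: le_trans h.
by rewrite mulrC ler_wpM2l// lerDl.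
Unshelve. all: by end_near. Qed.

(** The vector r of the overview. *)
Definition residual x (nu : hprod H m) : hprod H m :=
  dPhi (A x) (A (grad_lagrangian f F g x nu.1 nu.2)) +
  weigh (fun i => g0 i (A x) ^+ 2) nu.

Lemma etaE x (nu : hprod H m) :
  Defs.eta f F g x nu.1 nu.2 = 2^-1 * `|residual x nu| ^+ 2.
Proof.
rewrite /Defs.eta hprod_normE mulrDr /= addr0 enorm_sqrE; congr (_ * `| _ | ^+ 2 + _ * _).
  by case: (diff_factor (grad_lagrangian f F g x nu.1 nu.2) F_factor (F0_diff F0_C2 (A x))).
apply: eq_bigr => i _; rewrite !mxE g_factor.
have [gd gE] := diff_factor (grad_lagrangian f F g x nu.1 nu.2) (g_factor i)
  (g0_diff g0_C2 i (A x)).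
by rewrite -grad_spec// gE.
Qed.

Lemma residualE x (nu : hprod H m) : residual x nu =
  dPhi (A x) (A (grad f x)) + dPhi (A x) (dPhiT (A x) nu)
   + weigh (fun i => g0 i (A x) ^+ 2) nu.
Proof.
rewrite /residual grad_lagrangianE linearD AAstar; congr (_ + _).
by rewrite -{1}[A (grad f x)]scale1r dPhi_lin scale1r.
Qed.

(** With h = dPhi^T z, the first term on the right is the derivative of [f] at [x] along
    [adjoint A h]. This is how [<r, z>] enters the expansion of [f]. *)
Lemma inner_residual x (nu z : hprod H m) : inner (residual x nu) z =
  inner (A (grad f x)) (dPhiT (A x) z) +
  inner (dPhi (A x) (dPhiT (A x) z)) nu +
  \sum_i g0 i (A x) ^+ 2 * nu.2 0 i * z.2 0 i.
Proof.
by rewrite residualE !innerDl inner_weigh !dPhiT_spec// [inner (dPhiT _ z) _]innerC.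
Qed.

End Factored_problem.
(** The hypothesis is complementarity: [a <= 0], [b >= 0] and [a b = 0]. It is invariant under
    scaling [b] by a positive factor. *)
Lemma max_eq0 {R : realFieldType} (a b t : R) : 0 < t ->
  Num.max a (- b) = 0 -> Num.max a (- (t * b)) = 0 /\ a * b = 0.
Proof.
move=> t0; case: leP => [ab b0|ba a0].
  have {}b0 : b = 0 by lra.
  by move: ab; rewrite b0 !mulr0 oppr0 => a0; rewrite max_r.
by rewrite a0 mul0r; split => //; rewrite max_l// oppr_le0 mulr_ge0 ?(ltW t0)//; lra.
Qed.

(** Here [T] is |tau|, [rho] is |r| and [S] is the active error. Young's inequality splits [rho z]
    into [rho^2 / 4 + z^2]; half of [c k1 T^2] absorbs the part of [S z] that grows with [c], the
    other half absorbs the rest and leaves [T^2 + rho^2 / 4 <= 0]. *)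
Lemma exactness_arith {R : realFieldType} (c k1 T rho z S Z a b D : R) :
  0 <= T -> 0 <= z -> z <= Z * T -> 0 <= Z -> S <= (a + c * b) * T ->
  0 <= a -> 0 <= b -> 0 <= D -> 0 <= c -> b * Z <= k1 / 2 ->
  Z ^+ 2 + a * Z + D * Z ^+ 2 + 1 <= c * k1 / 2 ->
  c * k1 * T ^+ 2 + rho ^+ 2 / 2 <= rho * z + S * z + D * z ^+ 2 ->
  T = 0 /\ rho = 0.
Proof.
move=> T0 z0 zT Z0 ST a0 b0 D0 c0 bZ cB main.
have T2 : 0 <= T ^+ 2 := sqr_ge0 T.
have z2 : z ^+ 2 <= Z ^+ 2 * T ^+ 2.
  by rewrite -exprMn ler_sqr ?nnegrE ?mulr_ge0.
have h1 : rho * z <= rho ^+ 2 / 4 + z ^+ 2.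
  by have := sqr_ge0 (rho / 2 - z); rewrite sqrrB; clear; lra.
have h2 : S * z <= (a * Z + c * (b * Z)) * T ^+ 2.
  apply: le_trans (ler_wpM2r z0 ST) _.
  have -> : (a * Z + c * (b * Z)) * T ^+ 2 = (a + c * b) * T * (Z * T) by ring.
  by rewrite ler_wpM2l// !mulr_ge0// addr_ge0// mulr_ge0.
have h3 : c * (b * Z) * T ^+ 2 <= c * (k1 / 2) * T ^+ 2.
  by rewrite ler_wpM2r// ler_wpM2l.
have h4 : D * z ^+ 2 <= D * (Z ^+ 2 * T ^+ 2) by rewrite ler_wpM2l.
have h5 := ler_wpM2r T2 cB.
have rho2 := sqr_ge0 rho.
have : T ^+ 2 + rho ^+ 2 / 4 <= 0.
  by move: main h1 z2 h2 h3 h4 h5; clear; lra.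
move=> h; have /eqP : T ^+ 2 = 0 by move: h rho2 T2; clear; lra.
have /eqP : rho ^+ 2 = 0 by move: h rho2 T2; clear; lra.
by rewrite !sqrf_eq0 => /eqP -> /eqP ->.
Qed.

(** * Estimates at a single point *)

Section Pointwise.
Context {R : realType} {X H Y : hilbertType R} {m : nat}.
Variables (f : X -> R) (F : X -> H) (g : 'I_m -> X -> R).
Variables (A : {linear X -> Y}) (F0 : Y -> H) (g0 : 'I_m -> Y -> R).
Hypotheses (F_factor : forall x, F x = F0 (A x))
  (g_factor : forall i x, g i x = g0 i (A x))
  (f_diff : forall x, differentiable f x)
  (F0_C2 : C2 F0) (g0_C2 : forall i, C2 (g0 i))
  (AAstar : forall y, A (adjoint A y) = y).
Local Notation Phi := (Phi F0 g0).
Local Notation dPhi := (dPhi F0 g0).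
Local Notation dPhiT := (dPhiT F0 g0).
Local Notation residual := (residual f F g A F0 g0).

(** By [inner_residual] the slope of [f] along [adjoint A h] is [<r, z> - <dPhi h, nu>] minus the
    form of D. The solved equation replaces [dPhi h] by tau - D' z - [E]: tau produces the
    multiplier terms, [E] a quadratic error, and D - D' lives on the active constraints only. *)
Lemma pointwise_estimate (y0 : Y) x (nu z : hprod H m) (q : 'rV[R]_m) (L K M : R) :
  let h := dPhiT (A x) z in
  Phi (A x + h) - Phi (A x) + weigh (inactive_sqr g0 y0 (A x)) z = (- F x, - q) ->
  `|Phi (A x + h) - Phi (A x) - dPhi (A x) h| <= L * `|h| ^+ 2 ->
  f (x + adjoint A h) <= f x + 'd f x (adjoint A h) + M * `|adjoint A h| ^+ 2 ->
  `|nu| <= K ->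
  f (x + adjoint A h) <= f x + inner nu.1 (F x) + dotv nu.2 q
    + `|residual x nu| * `|z|
    + (\sum_i if active g0 y0 i then g0 i (A x) ^+ 2 * `|nu.2 0 i| else 0) * `|z|
    + (K * L + M) * `|h| ^+ 2.
Proof.
move=> h; set E := _ - dPhi _ _ => Ptau Eb fh nuK.
have dh : dPhi (A x) h = (- F x, - q) - weigh (inactive_sqr g0 y0 (A x)) z - E.
  by rewrite -Ptau addrK /E opprB addrC subrK.
have tauE : inner ((- F x, - q) : hprod H m) nu = - inner nu.1 (F x) - dotv nu.2 q.
  rewrite hprod_innerE /= innerNl innerC; congr (_ + _).
  by rewrite -scaleN1r -[_ *: q]addr0 dotv_linearl dotvC mulN1r;
    rewrite /dotv [X in _ + X]big1 ?addr0// => i _; rewrite mxE mul0r.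
have fE : 'd f x (adjoint A h) = inner (A (grad f x)) h.
  by rewrite grad_spec// -(adjoint_right_inverse_spec AAstar).
have rz := inner_residual F_factor g_factor f_diff F0_C2 g0_C2 AAstar x nu z.
rewrite -/h dh innerBl innerBl tauE inner_weigh in rz.
have rb := inner_le (residual x nu) z.
have Eb' : inner E nu <= K * L * `|h| ^+ 2.
  apply: le_trans (inner_le _ _) _; rewrite mulrC -mulrA.
  by apply: ler_pM.
have Sb : \sum_i inactive_sqr g0 y0 (A x) i * z.2 0 i * nu.2 0 i -
    \sum_i g0 i (A x) ^+ 2 * nu.2 0 i * z.2 0 i <=
  (\sum_i if active g0 y0 i then g0 i (A x) ^+ 2 * `|nu.2 0 i| else 0) * `|z|.
  rewrite -sumrB mulr_suml; apply: ler_sum => i _; rewrite /inactive_sqr.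
  case: ifP => _; last by rewrite mul0r mulrAC subrr.
  rewrite mul0r mul0r sub0r -mulrA -mulrN -[leRHS]mulrA ler_wpM2l ?sqr_ge0//.
  apply: le_trans (ler_norm _) _; rewrite normrN normrM ler_wpM2l//.
  exact: hprod_snd_le.
rewrite fE norm_adjointA// in fh.
apply: le_trans fh _; move: rz rb Eb' Sb; clear -F_factor g_factor f_diff F0_C2 g0_C2 AAstar; lra.
Qed.

Lemma KKT_residual x (nu : hprod H m) :
  KKT f F g x nu.1 nu.2 -> residual x nu = 0.
Proof.
move=> [gl _ gm]; rewrite /residual gl linear0.
have -> : dPhi (A x) 0 = 0.
  by have := dPhiB F0 g0 (A x) 0 0; rewrite !subrr.
rewrite add0r; apply: (_ : (_, _) = (0, 0)); congr pair.
apply/rowP => i; rewrite !mxE -g_factor expr2 -mulrA.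
have : vmax (gvec g x) (- nu.2) 0 i = 0 by rewrite gm mxE.
by rewrite !mxE => /(max_eq0 ltr01)[_ ->]; rewrite mulr0.
Qed.

(** The residual is affine in [nu] with linear part dPhi dPhi^T + D, which dominates the coercive
    dPhi dPhi^T + D'. *)
Lemma residual_inj (y0 : Y) (a : R) x (nu nu' : hprod H m) : 0 < a ->
  (forall nu : hprod H m, a * `|nu| ^+ 2 <= `|dPhiT (A x) nu| ^+ 2 +
     \sum_i inactive_sqr g0 y0 (A x) i * nu.2 0 i ^+ 2) ->
  residual x nu = residual x nu' -> nu = nu'.
Proof.
move=> a0 coer rr.
have sub_add3 (V : zmodType) (u b w b' w' : V) :
    u + b + w - (u + b' + w') = (b - b') + (w - w').
  by rewrite opprD addrACA; congr (_ + _); rewrite opprD addrACA subrr add0r.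
have rB : residual x nu - residual x nu' = dPhi (A x) (dPhiT (A x) (nu - nu')) +
    weigh (fun i => g0 i (A x) ^+ 2) (nu - nu').
  rewrite !(residualE F_factor g_factor f_diff F0_C2 g0_C2 AAstar) sub_add3.
  by rewrite -dPhiB -(dPhiTB F0_C2 g0_C2) -weighB.
have : inner (residual x nu - residual x nu') (nu - nu') = 0.
  by rewrite rr subrr inner0l.
rewrite rB innerDl (dPhiT_spec F0_C2 g0_C2) inner_norm inner_weigh => h {rr rB}.
have := coer (nu - nu').
have : \sum_i inactive_sqr g0 y0 (A x) i * (nu - nu').2 0 i ^+ 2 <=
    \sum_i g0 i (A x) ^+ 2 * (nu - nu').2 0 i * (nu - nu').2 0 i.
  apply: ler_sum => i _; rewrite -mulrA -expr2 /inactive_sqr.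
  case: ifP => _; last exact: lexx.
  by rewrite mul0r; apply: mulr_ge0; exact: sqr_ge0.
have n0 := sqr_ge0 `|nu - nu'|.
move=> h1 h2; have : a * `|nu - nu'| ^+ 2 <= 0.
  by move: h h1 h2; clear -F_factor g_factor f_diff F0_C2 g0_C2 AAstar; lra.
rewrite pmulr_rle0// => n1; apply/eqP; rewrite -subr_eq0 -normr_eq0 -sqrf_eq0.
by rewrite eq_le n1 n0.
Qed.

(** Pairing the residual with [nu] gives [a |nu|^2 <= |r| |nu| + M L |nu|]. The crude bound
    [|r| <= 1 + |r|^2] avoids a square root. *)
Lemma multiplier_bound (y0 : Y) (a L M E0 : R) x (nu : hprod H m) :
  0 < a -> 0 <= M ->
  (forall nu : hprod H m, a * `|nu| ^+ 2 <= `|dPhiT (A x) nu| ^+ 2 +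
     \sum_i inactive_sqr g0 y0 (A x) i * nu.2 0 i ^+ 2) ->
  0 <= L -> (forall v, `|dPhi (A x) v| <= L * `|v|) ->
  (forall v, `|'d f x v| <= M * `|v|) ->
  2^-1 * `|residual x nu| ^+ 2 <= E0 ->
  `|nu| <= (1 + 2 * E0 + M * L) / a.
Proof.
move=> a0 M0 coer L0 dL fM rE0.
have gradM : `|grad f x| <= M.
  have [->|w0] := eqVneq (grad f x) 0; first by rewrite normr0.
  have wp : 0 < `|grad f x| by rewrite normr_gt0.
  rewrite -(ler_pM2r wp) -expr2 -inner_norm -grad_spec//.
  exact: le_trans (ler_norm _) (fM _).
have := inner_residual F_factor g_factor f_diff F0_C2 g0_C2 AAstar x nu nu.
rewrite (dPhiT_spec F0_C2 g0_C2) inner_norm => rE.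
have [->|nu0] := eqVneq nu 0.
  rewrite normr0 divr_ge0// ?(ltW a0)//.
  have := sqr_ge0 `|residual x nu|; have : 0 <= M * L by rewrite mulr_ge0.
  by move: rE0; clear -F_factor g_factor f_diff F0_C2 g0_C2 AAstar; lra.
have np : 0 < `|nu| by rewrite normr_gt0.
rewrite ler_pdivlMr// -(ler_pM2r np).
have h1 : - (M * (L * `|nu|)) <= inner (A (grad f x)) (dPhiT (A x) nu).
  have := cauchy_schwarz (A (grad f x)) (dPhiT (A x) nu).
  rewrite ler_norml => /andP[+ _]; apply: le_trans; rewrite lerN2.
  apply: ler_pM => //; last exact: dPhiT_le.
  exact: le_trans (normA_le AAstar _) gradM.
have h2 : \sum_i inactive_sqr g0 y0 (A x) i * nu.2 0 i ^+ 2 <=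
    \sum_i g0 i (A x) ^+ 2 * nu.2 0 i * nu.2 0 i.
  apply: ler_sum => i _; rewrite -mulrA -expr2 /inactive_sqr.
  case: ifP => _; last exact: lexx.
  by rewrite mul0r; apply: mulr_ge0; exact: sqr_ge0.
have h3 : inner (residual x nu) nu <= (1 + 2 * E0) * `|nu|.
  apply: le_trans (inner_le _ _) _; rewrite ler_wpM2r//.
  have := sqr_ge0 (`|residual x nu| - 1); rewrite sqrrB1 -mulr_natl.
  have := sqr_ge0 `|residual x nu|.
  by move: rE0; clear -F_factor g_factor f_diff F0_C2 g0_C2 AAstar; lra.
by have := coer nu; move: rE h1 h2 h3; clear -F_factor g_factor f_diff F0_C2 g0_C2 AAstar; lra.
Qed.

End Pointwise.
(** * Exactness *)

Lemma optimal_valueE {R : realType} {X H : hilbertType R} {m : nat}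
    (f : X -> R) (F : X -> H) (g : 'I_m -> X -> R) x :
  globally_optimal f F g x -> optimal_value f F g = f x.
Proof.
move=> [xf xmin]; apply/eqP; rewrite eq_le; apply/andP; split.
  by apply: ge_inf; [exists (f x) => _ [y yf <-]; exact: xmin|exists x].
by apply: lb_le_inf; [exists (f x); exists x|move=> _ [y yf <-]; exact: xmin].
Qed.

(** * Points whose constraint values are close to those of a feasible point *)

Section Near_optimal.
Context {R : realType} {X H Y : hilbertType R} {m : nat}.
Variables (F : X -> H) (g : 'I_m -> X -> R) (phi : R -> \bar R) (psi : 'rV[R]_m -> R).
Variables (A : {linear X -> Y}) (F0 : Y -> H) (g0 : 'I_m -> Y -> R).
Hypotheses (F_factor : forall x, F x = F0 (A x))
  (g_factor : forall i x, g i x = g0 i (A x)).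
Variables (x0 x : X) (e : R).
Hypotheses (x0_feasible : feasible F g x0)
  (xe : `|Phi F0 g0 (A x) - Phi F0 g0 (A x0)| <= e).

Lemma near_constraint i : `|g i x - g i x0| <= e.
Proof.
have := hprod_snd_le (Phi F0 g0 (A x) - Phi F0 g0 (A x0)) i.
by rewrite !mxE -!g_factor => /le_trans; apply.
Qed.

Lemma near_violation : `|F x| ^+ 2 + enorm (vmax (gvec g x) 0) ^+ 2 <= e ^+ 2.
Proof.
have [F00 g00] := x0_feasible.
apply: le_trans (_ : `|Phi F0 g0 (A x) - Phi F0 g0 (A x0)| ^+ 2 <= _); last first.
  by rewrite ler_sqr ?nnegrE// (le_trans _ xe).
rewrite hprod_normE; apply: lerD.
  by rewrite /= -!F_factor F00 subr0.
rewrite !enorm_sqrE; apply: ler_sum => i _; rewrite !mxE -!g_factor.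
have := g00 i; case: (leP (g i x) 0) => [_|gp] gi; first by rewrite expr0n sqr_ge0.
by rewrite ler_sqr ?nnegrE ?subr_ge0 ?(ltW gp) ?(le_trans gi (ltW gp))//; lra.
Qed.

Lemma near_Omega (alpha s : R) : psi_admissible psi ->
  (forall t, 0 <= t < alpha -> (phi t < +oo)%E) ->
  (forall y : 'rV[R]_m, orthant y -> (forall i, y 0 i < s) -> psi 0 / 2 <= psi y) ->
  e <= 1 -> e < alpha -> e < s ->
  Omega F g phi psi x /\ psi 0 / 2 <= slack g psi x.
Proof.
move=> psi_adm phi_fin psi_s e1 ea es.
have e0 : 0 <= e by exact: le_trans xe.
have vio := near_violation.
have sl : psi 0 / 2 <= slack g psi x.
  apply: psi_s; first exact: orthant_vmax.
  move=> i; apply: le_lt_trans es.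
  rewrite -ler_sqr ?nnegrE//; last by rewrite !mxE le_max lexx orbT.
  apply: le_trans (sqr_coord_le _ i) _; apply: le_trans vio.
  by rewrite lerDr sqr_ge0.
split => //; split; first by apply: lt_le_trans sl; rewrite divr_gt0// psi0_gt0.
apply: phi_fin; rewrite sqr_ge0/=; apply: le_lt_trans ea.
apply: le_trans (_ : e ^+ 2 <= _); last by rewrite expr2 ler_piMl.
by apply: le_trans vio; rewrite lerDl sqr_ge0.
Qed.

End Near_optimal.

(** If the maximum is [u], then [|u| <= T] and the bound is [K T]. Otherwise [|v| <= (c / p) T], and
    [u^2 <= e] supplies the small factor that compensates for [c]. *)
Lemma active_multiplier_le {R : realType} (c p p0 K T e u v : R) :
  0 < c -> 0 < p0 -> p0 <= p -> 0 <= e -> e <= 1 -> `|u| <= e -> `|v| <= K ->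
  `|Num.max u (- (c^-1 * p * v))| <= T ->
  u ^+ 2 * `|v| <= (K + c * (e / p0)) * T.
Proof.
move=> c0 p00 pp e0 e1 ue vK; have K0 : 0 <= K := le_trans (normr_ge0 _) vK.
have p0' : 0 < p := lt_le_trans p00 pp.
have u2 : u ^+ 2 = `|u| * `|u| by rewrite -expr2 real_normK// num_real.
have cp : 0 <= c * (e / p0) by rewrite mulr_ge0 ?(ltW c0)// divr_ge0// ltW.
case: (leP u (- (c^-1 * p * v))) => _ T0; last first.
  have T0' : 0 <= T by exact: le_trans (normr_ge0 _) T0.
  apply: le_trans (_ : K * T <= _); last by rewrite mulrDl lerDl; exact: mulr_ge0.
  rewrite u2 [leLHS]mulrC; apply: ler_pM => //.
  rewrite -[T]mul1r; apply: ler_pM => //; exact: le_trans ue e1.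
have T0' : 0 <= T by exact: le_trans (normr_ge0 _) T0.
have vE : `|v| <= c / p0 * T.
  move: T0; rewrite normrN !normrM (ger0_norm (ltW p0')) ger0_norm ?invr_ge0 ?(ltW c0)//.
  move=> h; apply: le_trans (_ : c / p * T <= _).
    have -> : `|v| = c / p * (c^-1 * p * `|v|) by field; rewrite !gt_eqF.
    by rewrite ler_wpM2l// divr_ge0// ltW.
  by rewrite ler_wpM2r// ler_wpM2l ?(ltW c0)// lef_pV2 ?posrE.
apply: le_trans (_ : c * (e / p0) * T <= _); last by rewrite mulrDl lerDr; exact: mulr_ge0.
have -> : c * (e / p0) * T = e * (c / p0 * T) by ring.
apply: ler_pM => //; first exact: sqr_ge0.
by rewrite u2 -[e]mulr1; apply: ler_pM => //; exact: le_trans ue e1.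
Qed.
Lemma local_exactness (R : realType) (X H Y : hilbertType R) (m : nat)
  (f : X -> R) (F : X -> H) (g : 'I_m -> X -> R)
  (phi : R -> \bar R) (psi : 'rV[R]_m -> R)
  (A : {linear X -> Y}) (F0 : Y -> H) (g0 : 'I_m -> Y -> R)
  (phi_adm : phi_admissible phi) (psi_adm : psi_admissible psi)
  (optimal_KKT : forall x, globally_optimal f F g x ->
     exists l mu, KKT f F g x l mu)
  (F_factor : forall x, F x = F0 (A x))
  (g_factor : forall i x, g i x = g0 i (A x))
  (f_C2 : C2 f) (F0_C2 : C2 F0) (g0_C2 : forall i, C2 (g0 i))
  (phi_C1 : exists dphi : R -> R,
     C1_within (edom phi) (fun t => fine (phi t)) (fun t h => dphi t * h) /\
     0 < dphi 0)
  (r eps : R) (r_gt0 : 0 < r) (eps_gt0 : 0 < eps)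
  (AAstar : forall y, A (adjoint A y) = y) (x0 : X) :
  bounded_up_to_order2 f (Omega_sub f F g phi psi r (f x0 + eps)) ->
  globally_optimal f F g x0 -> Q0_positive_definite F0 g0 (A x0) ->
  exists d c0 : R, [/\ 0 < d, 0 < c0 & forall c x l mu,
    c0 <= c -> `|A x - A x0| <= d ->
    (augmented_lagrangian f F g phi psi c x l mu <= (f x0)%:E)%E ->
    globally_optimal f F g x /\ KKT f F g x l mu].
Proof.
move=> [M fM] x0_opt [a0 a00 Qa].
have f_diff x : differentiable f x by case: f_C2 => -[].
have [x0_feas x0_min] := x0_opt.
have psi0 := psi0_gt0 psi_adm.
have [L [a [e0 [L0 a_gt0 e00 Phi_lip geo]]]] := local_geometry F0_C2 g0_C2 a00
  (fun nu => eq_ind_r (fun t => a0 * t <= _) (Qa nu.1 nu.2) (hprod_normE nu)).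
have [k [alpha [k0 alpha0 phi_fin phi_k]]] := phi_linear_growth phi_adm phi_C1.
have [s s0 psi_s] := psi_lower_near0 psi_adm.
(* [x0] itself lies in the sublevel set, so [M] bounds [|f x0|]. *)
have M0 : 0 <= M.
  have P0 : `|Phi F0 g0 (A x0) - Phi F0 g0 (A x0)| <= 0 by rewrite subrr normr0.
  have [Ox0 _] := near_Omega F_factor g_factor x0_feas P0 psi_adm phi_fin psi_s
    ler01 alpha0 s0.
  have vio := near_violation F_factor g_factor x0_feas P0.
  have [|fb _ _] := fM x0; last exact: le_trans fb.
  split => //; apply: lerD; first exact: lexx.
  by apply: le_trans (ltW eps_gt0); rewrite pmulr_rle0// (le_trans vio)// expr0n.

(* Choice of the constants, all independent of [c] *)
pose k1 := Num.min (k / 2) (4 * psi 0)^-1.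
have k10 : 0 < k1 by rewrite lt_min !divr_gt0// invr_gt0 mulr_gt0.
have k1k : k1 <= k / 2 by rewrite ge_min lexx.
have k1psi : k1 <= (2 * psi 0)^-1.
  apply: le_trans (_ : (4 * psi 0)^-1 <= _); first by rewrite ge_min lexx orbT.
  by rewrite lef_pV2 ?posrE ?mulr_gt0// ler_pM2r// ler_nat.
pose C0 := (2 * k)^-1 + psi 0.
have C00 : 0 < C0 by rewrite addr_gt0// invr_gt0 mulr_gt0.
pose E0 := `|f x0| + M + C0.
have E00 : 0 < E0 by rewrite ltr_wpDl// addr_ge0.
pose K0 := (1 + 2 * E0 + M * L) / a.
have K00 : 0 <= K0.
  by rewrite divr_ge0 ?(ltW a_gt0)// addr_ge0 ?mulr_ge0 ?(ltW L0)// addr_ge0// mulr_ge0// ltW.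
pose p0 := psi 0 / 2 / (1 + K0 ^+ 2).
have p00 : 0 < p0 by rewrite !divr_gt0// ltr_wpDr// sqr_ge0.
pose Z := 4 / a.
have Z0 : 0 < Z by rewrite divr_gt0.
(* Bounds by [alpha] and [s] give membership in [Omega]; [eps / (2 r)] keeps the penalty term of the
   sublevel set below [eps / 2]; the bound with [k1] makes the active error absorbable ([bSZ]); the
   last one keeps inactive constraints negative. *)
have [e [e_gt0 e1 [ea es] [er em] eact]] : exists e, [/\ 0 < e, e <= 1,
    e < alpha /\ e < s,
    e <= eps / (2 * r) /\ e <= k1 / 2 / (m.+1%:R / p0 * Z) &
    forall i, ~~ active g0 (A x0) i -> e < `|g i x0|].
  near (0 : R)^'+ => e; exists e; split.
  - by near: e; exact: nbhs_right_gt.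
  - by near: e; exact: nbhs_right_le.
  - by split; near: e; exact: nbhs_right_lt.
  - by split; near: e; apply: nbhs_right_le; rewrite !divr_gt0// !mulr_gt0// ?invr_gt0.
  - near: e; apply: filter_forall => i; case: (boolP (active g0 (A x0) i)) => act.
      by apply: nearW.
    have gi : 0 < `|g i x0| by rewrite normr_gt0 g_factor.
    by apply: filterS (nbhs_right_lt gi).
have near_ok x : `|A x - A x0| <= Num.min e0 (e / (2 * L)) ->
    `|Phi F0 g0 (A x) - Phi F0 g0 (A x0)| <= e.
  rewrite le_min => /andP[xe0 xe]; apply: le_trans (Phi_lip _ xe0) _.
  by rewrite mulrC -ler_pdivlMr ?mulr_gt0.
have [||d [t [d0 de t0 {}geo]]] := geo (Num.min e0 (e / (2 * L))).
- by rewrite lt_min e00 divr_gt0// mulr_gt0.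
- by rewrite ge_min lexx.
have Omega_r x : `|A x - A x0| <= Num.min e0 (e / (2 * L)) -> f x <= f x0 + eps / 2 ->
    Omega_sub f F g phi psi r (f x0 + eps) x /\ psi 0 / 2 <= slack g psi x.
  move=> xe fx; have Pe := near_ok _ xe.
  have [Ox sl] := near_Omega F_factor g_factor x0_feas Pe psi_adm phi_fin psi_s e1 ea es.
  have vio := near_violation F_factor g_factor x0_feas Pe.
  split => //; split => //.
  have ee : e ^+ 2 <= e by rewrite expr2 ler_piMl// ltW.
  have : r * (`|F x| ^+ 2 + enorm (vmax (gvec g x) 0) ^+ 2) <= r * e.
    by rewrite ler_wpM2l ?(ltW r_gt0)// (le_trans vio).
  have : r * e <= eps / 2.
    have -> : eps / 2 = r * (eps / (2 * r)) by field; rewrite gt_eqF.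
    by rewrite ler_wpM2l// ltW.
  by move: fx; clear; lra.
(* The second entry ensures [M * |h| <= eps / 8], the total increase of [f] permitted when
   [stay_below] is applied. *)
pose t1 := Num.min t (eps / (8 * (M * L * Z + 1))).
have MLZ0 : 0 <= M * L * Z := mulr_ge0 (mulr_ge0 M0 (ltW L0)) (ltW Z0).
have t10 : 0 < t1 by rewrite lt_min t0 divr_gt0// mulr_gt0// ltr_wpDl.
pose aS := m.+1%:R * K0; pose bS := m.+1%:R * (e / p0).
pose D := (K0 * L + M) * L ^+ 2.
have D0 : 0 <= D.
  exact: mulr_ge0 (addr_ge0 (mulr_ge0 K00 (ltW L0)) M0) (sqr_ge0 L).
have aS0 : 0 <= aS := mulr_ge0 (ler0n _ _) K00.
have bS0 : 0 <= bS := mulr_ge0 (ler0n _ _) (divr_ge0 (ltW e_gt0) (ltW p00)).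
have bSZ : bS * Z <= k1 / 2.
  have mp : 0 < m.+1%:R / p0 * Z by rewrite mulr_gt0// divr_gt0.
  move: em; rewrite ler_pdivlMr//; apply: le_trans.
  by rewrite le_eqVlt; apply/orP; left; apply/eqP; rewrite /bS; ring.
pose B := Z ^+ 2 + aS * Z + D * Z ^+ 2 + 1.
have B0 : 0 < B.
  apply: ltr_wpDl => //; apply: addr_ge0; last exact: mulr_ge0 D0 (sqr_ge0 _).
  exact: addr_ge0 (sqr_ge0 _) (mulr_ge0 aS0 (ltW Z0)).
(* The summands ensure, in turn, [1 <= c], [C0 / c <= eps / 4], [|tau| <= t1] and
   [B <= c k1 / 2]. *)
pose c0 := 1 + 4 * C0 / eps + E0 / (k1 * t1 ^+ 2) + 2 * B / k1.
have c0a : 0 <= 4 * C0 / eps := divr_ge0 (mulr_ge0 (ler0n _ 4) (ltW C00)) (ltW eps_gt0).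
have t12 : 0 < t1 ^+ 2 by rewrite exprn_gt0.
have c0b : 0 <= E0 / (k1 * t1 ^+ 2) := divr_ge0 (ltW E00) (mulr_ge0 (ltW k10) (ltW t12)).
have c0c : 0 <= 2 * B / k1 := divr_ge0 (mulr_ge0 (ler0n _ 2) (ltW B0)) (ltW k10).
exists d, c0; split => //.
  by rewrite /c0; move: c0a c0b c0c; clear; lra.

(* Bounds on a triple whose value is at most [f x0] *)
move=> c x l mu c0c' xd AL.
have [c1 cC0 cE0 cB] : [/\ 1 <= c, 4 * C0 / eps <= c, E0 / (k1 * t1 ^+ 2) <= c & 2 * B / k1 <= c].
  by move: c0c'; rewrite /c0; move: c0a c0b c0c; clear; split; lra.
have c_gt0 : 0 < c by exact: lt_le_trans c1.
pose nu : hprod H m := (l, mu).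
pose q := shifted_constraint g psi c x mu.
pose tau : hprod H m := (- F x, - q).
pose e' := Num.min e0 (e / (2 * L)).
have xe' : `|A x - A x0| <= e' := le_trans xd de.
have tau2 : `|tau| ^+ 2 = `|F x| ^+ 2 + enorm q ^+ 2.
  rewrite hprod_normE /= normrN !enorm_sqrE; congr (_ + _).
  by apply: eq_bigr => i _; rewrite mxE sqrrN.
have qE i : q 0 i = Num.max (g i x) (- (c^-1 * penalty_weight g psi x mu * mu 0 i)).
  by rewrite !mxE.
have [Ox ALR] := auglag_leP AL.
have lower := auglag_lower psi_adm k0 c_gt0 phi_k AL.
pose rho := residual f F g A F0 g0 x nu.
have eta_rho : Defs.eta f F g x l mu = 2^-1 * `|rho| ^+ 2.
  exact: (etaE f F_factor g_factor F0_C2 g0_C2 AAstar x nu).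
rewrite -/k1 -/C0 -/q -tau2 eta_rho in lower.
rewrite -/q eta_rho in ALR.
clearbody q.
have rho2 := sqr_ge0 `|rho|.
have kT0 : 0 <= c * k1 * `|tau| ^+ 2.
  exact: mulr_ge0 (mulr_ge0 (ltW c_gt0) (ltW k10)) (sqr_ge0 _).
have C0c : C0 / c <= eps / 4.
  rewrite ler_pdivrMr//; move: cC0; rewrite ler_pdivrMr//; clear; lra.
have C0c' : C0 / c <= C0 by rewrite ler_pdivrMr// ler_peMr// ltW.
have fx : f x <= f x0 + eps / 4.
  by move: lower rho2 kT0 C0c; clear; lra.
have fx2 : f x <= f x0 + eps / 2 by move: fx eps_gt0; clear; lra.
have [Oxr slx] := Omega_r _ xe' fx2.
have [fxM dfM _] := fM _ Oxr.
have fxE0 : f x0 + C0 - f x <= E0.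
  move: fxM; rewrite ler_norml => /andP[h _]; have := ler_norm (f x0).
  by rewrite /E0; move: h; clear; lra.
have etaE0 : 2^-1 * `|rho| ^+ 2 <= E0.
  by move: lower kT0 C0c' fxE0; clear; lra.
have TE0 : c * k1 * `|tau| ^+ 2 <= E0.
  by move: lower rho2 C0c' fxE0; clear; lra.
have Tt1 : `|tau| <= t1.
  rewrite -ler_sqr ?nnegrE ?(ltW t10)//.
  have ck : 0 < c * k1 by rewrite mulr_gt0.
  rewrite -(ler_pM2l ck); apply: le_trans TE0 _.
  move: cE0; rewrite ler_pdivrMr ?mulr_gt0//.
  by rewrite mulrA.
have Tt : `|tau| <= t by apply: le_trans Tt1 _; rewrite ge_min lexx.
have [dL coer solve PhiL] := geo _ xd.
have nuK : `|nu| <= K0.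
  exact: (multiplier_bound F_factor g_factor f_diff F0_C2 g0_C2 AAstar a_gt0 M0
    coer (ltW L0) dL dfM etaE0).

(* The feasible comparison point *)
have [z [zT yball Pz]] := solve tau Tt.
rewrite -/Z in zT.
pose h := dPhiT F0 g0 (A x) z.
have hz : `|h| <= L * `|z| := dPhiT_le F0_C2 g0_C2 z (ltW L0) dL.
have Mh : M * `|h| <= eps / 8.
  apply: le_trans (_ : M * L * Z * `|tau| <= _).
    rewrite -2!mulrA; apply: ler_wpM2l => //; apply: le_trans hz _.
    by apply: ler_wpM2l => //; exact: ltW.
  apply: le_trans (_ : M * L * Z * (eps / (8 * (M * L * Z + 1))) <= _).
    apply: ler_wpM2l => //; apply: le_trans Tt1 _.
    by rewrite ge_min lexx orbT.
  have q1 : 0 < M * L * Z + 1 by rewrite ltr_wpDl.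
  have -> : M * L * Z * (eps / (8 * (M * L * Z + 1))) =
      eps / 8 * (M * L * Z / (M * L * Z + 1)) by field; rewrite gt_eqF.
  rewrite ler_piMr ?divr_ge0 ?(ltW eps_gt0)// ler_pdivrMr// mul1r.
  by rewrite lerDl.
pose u := adjoint A h.
have uh : `|u| = `|h| := norm_adjointA AAstar h.
have Aseg (s' : R) : 0 <= s' <= 1 -> `|A (x + s' *: u) - A x0| <= e'.
  move=> s01; rewrite linearD linearZ AAstar.
  have yb : `|A x + h - A x0| <= e' := yball.
  have := norm_segment s01 xe' yb.
  by rewrite [A x + h - A x]addrAC subrr add0r.
(* The bound [M] on the derivative is available only where [f <= f x0 + eps / 2], which is the
   conclusion itself; [stay_below] breaks the circle. *)
have fseg (s' : R) : 0 <= s' <= 1 -> f (x + s' *: u) <= f x0 + eps / 2.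
  move: s'; apply: (stay_below (e := eps / 8)) => //.
  - move=> s' s01 fs; have [Os _] := Omega_r _ (Aseg _ s01) fs.
    have [_ dfs _] := fM _ Os.
    by apply: le_trans (ler_norm _) _; apply: le_trans (dfs u) _; rewrite uh.
  - by rewrite divr_ge0// ltW.
  - by move: fx eps_gt0; clear; lra.
have taylor : f (x + u) <= f x + 'd f x u + M * `|u| ^+ 2.
  apply: taylor_upper_bound => // s' s01 v w.
  have [Os _] := Omega_r _ (Aseg _ s01) (fseg _ s01).
  by have [_ _] := fM _ Os.
have Axu : A (x + u) = A x + h by rewrite linearD AAstar.
have xu_feas : feasible F g (x + u).
  split.
    have := congr1 fst Pz; rewrite /= addr0 -/h -Axu -!F_factor.
    by move/(congr1 (fun w => w + F x)); rewrite subrK addNr.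
  (* For an active constraint the weight is 0, so its new value is exactly [g i x - q 0 i <= 0]; an
     inactive one moves from its value at [x0] by at most [e < |g i x0|]. *)
  move=> i; case: (boolP (active g0 (A x0) i)) => act.
    have := congr1 (fun w : hprod H m => w.2 0 i) Pz.
    rewrite !mxE -/h -Axu -!g_factor /inactive_sqr act mul0r addr0.
    have : g i x <= q 0 i by rewrite qE le_max lexx.
    by clear; lra.
  have xue : `|A (x + u) - A x0| <= e' by rewrite Axu; exact: yball.
  have := near_constraint g_factor (near_ok _ xue) i; have := eact i act.
  have := x0_feas.2 i; move=> g00; rewrite ler0_norm// ler_norml => g1 /andP[_ g2].
  by move: g1 g2; clear; lra.

(* Comparison of the two values *)
have key := pointwise_estimate F_factor g_factor f_diff F0_C2 g0_C2 AAstar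
  Pz (PhiL _ yball) taylor nuK.
rewrite -/rho -/h /= in key; have fopt := x0_min _ xu_feas.
set S := \sum_i _ in key.
have p0p : p0 <= penalty_weight g psi x mu.
  have K2 : enorm mu ^+ 2 <= K0 ^+ 2.
    apply: le_trans (_ : `|nu| ^+ 2 <= _); first by rewrite hprod_normE lerDr sqr_ge0.
    by rewrite ler_sqr ?nnegrE.
  apply: ler_pM; [by rewrite divr_ge0// ltW| |exact: slx|].
    by rewrite invr_ge0 addr_ge0// sqr_ge0.
  by rewrite lef_pV2 ?posrE ?ltr_wpDr ?sqr_ge0// lerD2l.
have pp : 0 < penalty_weight g psi x mu := lt_le_trans p00 p0p.
have ppsi := penalty_weight_le0 psi_adm mu Ox.
have cep : 0 <= K0 + c * (e / p0).
  exact: addr_ge0 K00 (mulr_ge0 (ltW c_gt0) (divr_ge0 (ltW e_gt0) (ltW p00))).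
have term_ge0 : 0 <= (K0 + c * (e / p0)) * `|tau| := mulr_ge0 cep (normr_ge0 tau).
have ST : S <= (aS + c * bS) * `|tau|.
  apply: le_trans (_ : \sum_(i < m) (K0 + c * (e / p0)) * `|tau| <= _).
    apply: ler_sum => i _; case: ifP => [act|_]; last exact: term_ge0.
    apply: (active_multiplier_le c_gt0 p00 p0p (ltW e_gt0) e1).
    - have := near_constraint g_factor (near_ok _ xe') i.
      rewrite -!g_factor; move/eqP: act; rewrite -g_factor => ->.
      by rewrite subr0.
    - exact: le_trans (hprod_snd_le nu i) nuK.
    - have := hprod_snd_le tau i; by rewrite !mxE normrN qE g_factor.
  rewrite sumr_const card_ord -mulr_natl.
  have -> : aS + c * bS = m.+1%:R * (K0 + c * (e / p0)).
    by rewrite /aS /bS; ring.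
  by rewrite -[leRHS]mulrA ler_wpM2r ?ler_nat.
have phiF := phi_k _ (sqr_ge0 _) Ox.2.
have h1 : c * k1 * `|F x| ^+ 2 <= c / 2 * (1 + `|l| ^+ 2) * fine (phi (`|F x| ^+ 2)).
  apply: le_trans (_ : c / 2 * (k * `|F x| ^+ 2) <= _).
    have -> : c / 2 * (k * `|F x| ^+ 2) = c * (k / 2) * `|F x| ^+ 2 by ring.
    by rewrite ler_wpM2r ?sqr_ge0// ler_wpM2l// ltW.
  have c20 : 0 <= c / 2 by rewrite divr_ge0// ltW.
  apply: le_trans (ler_wpM2l c20 phiF) _; rewrite -mulrA ler_wpM2l//.
  by rewrite ler_peMl// ?lerDl ?sqr_ge0// (le_trans _ phiF)// mulr_ge0 ?sqr_ge0// ltW.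
have h2 : c * k1 * enorm q ^+ 2 <= c / (2 * penalty_weight g psi x mu) * enorm q ^+ 2.
  rewrite ler_wpM2r ?sqr_ge0// ler_wpM2l ?(ltW c_gt0)//.
  have pp2 : 0 < 2 * penalty_weight g psi x mu := mulr_gt0 (ltr0n _ 2) pp.
  have psi2 : 0 < 2 * psi 0 := mulr_gt0 (ltr0n _ 2) psi0.
  by apply: le_trans k1psi _; rewrite lef_pV2 ?posrE// ler_pM2l.
have h3 : (K0 * L + M) * `|h| ^+ 2 <= D * `|z| ^+ 2.
  rewrite /D -mulrA -exprMn; apply: ler_wpM2l.
    exact: addr_ge0 (mulr_ge0 K00 (ltW L0)) M0.
  by rewrite ler_sqr ?nnegrE// mulr_ge0// ltW.
(* The terms [inner l (F x)] and [dotv mu q] occur both in the value of the augmented Lagrangian and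
   in the upper bound [key], and cancel when [f x0 <= f (x + u)] is inserted. *)
have h4 : c * k1 * `|tau| ^+ 2 + `|rho| ^+ 2 / 2 <=
    `|rho| * `|z| + S * `|z| + D * `|z| ^+ 2.
  rewrite tau2; move: key fopt ALR h1 h2 h3; rewrite -/u; clear; lra.
have cB' : B <= c * k1 / 2.
  by move: cB; rewrite ler_pdivrMr//; clear; lra.
have [T0 rho0] := exactness_arith (normr_ge0 tau) (normr_ge0 z) zT (ltW Z0) ST
  aS0 bS0 D0 (ltW c_gt0) bSZ cB' h4.

(* Optimality of [x] and identification of the multipliers *)
have F0x : `|F x| ^+ 2 + enorm q ^+ 2 = 0 by rewrite -tau2 T0 expr0n.
have q0 : q = 0.
  by apply: enorm_eq0; move: F0x (sqr_ge0 `|F x|); clear; lra.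
have Fx0 : F x = 0.
  apply/eqP; rewrite -normr_eq0 -sqrf_eq0; apply/eqP.
  by move: F0x (sqr_ge0 `|F x|) (sqr_ge0 (enorm q)); clear; lra.
have q_max i : Num.max (g i x) (- (c^-1 * penalty_weight g psi x mu * mu 0 i)) = 0.
  by rewrite -qE q0 mxE.
have x_feas : feasible F g x.
  by split => // i; rewrite -(q_max i) le_max lexx.
have x_opt : globally_optimal f F g x.
  split => // y y_feas; apply: le_trans (x0_min _ y_feas).
  move: ALR h1 h2; rewrite q0 Fx0 inner0r normr0 rho0.
  have -> : dotv mu 0 = 0 by rewrite /dotv big1// => i _; rewrite mxE mulr0.
  have -> : enorm (0 : 'rV[R]_m) ^+ 2 = 0.
    by rewrite enorm_sqrE big1// => i _; rewrite mxE expr0n.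
  by rewrite expr0n /=; clear; lra.
split => //.
(* Some KKT multipliers exist at the optimal [x]. The residual vanishes for them as for [nu], so
   injectivity makes them equal to [nu]. *)
have [l' [mu' kkt]] := optimal_KKT _ x_opt.
have r0' : residual f F g A F0 g0 x ((l', mu') : hprod H m) = 0 :=
  KKT_residual F0 (nu := ((l', mu') : hprod H m)) g_factor kkt.
have r0 : residual f F g A F0 g0 x nu = 0 by apply/eqP; rewrite -normr_eq0 -/rho rho0.
have := residual_inj F_factor g_factor f_diff F0_C2 g0_C2 AAstar a_gt0 coer (etrans r0 (esym r0')).
by move=> /= [-> ->].
Unshelve. all: by end_near. Qed.
Lemma limn_einf_le {R : realType} (v : (\bar R)^nat) (b : \bar R) :
  (\forall n \near \oo, v n <= b)%E -> (limn_einf v <= b)%E.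
Proof.
move=> vb; rewrite limn_einf_lim; apply: lime_le; first exact: is_cvg_einfs.
apply: nearW => n; near \oo => j.
apply: (@le_trans _ _ (v j)); last by near: j.
apply: ereal_inf_lbound; exists j => //.
by rewrite /=; near: j; exists n.
Unshelve. all: by end_near. Qed.

(** Complementarity annihilates the shifted constraint and the terms [g_i^2 mu_i] of [eta]. Thus all
    KKT triples at optimal points share the optimal value. *)
Lemma auglag_KKT {R : realType} {X H : hilbertType R} {m : nat}
    (f : X -> R) (F : X -> H) (g : 'I_m -> X -> R)
    (phi : R -> \bar R) (psi : 'rV[R]_m -> R) (c : R) x l mu :
  phi_admissible phi -> psi_admissible psi -> 0 < c ->
  (forall i, differentiable (g i) x) -> differentiable F x ->
  KKT f F g x l mu ->
  augmented_lagrangian f F g phi psi c x l mu = (f x)%:E.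
Proof.
move=> [_ [phi0 _ _]] psi_adm c0 gd Fd [gl Fx gm].
have phi00 : phi 0 = 0%E by apply/phi0.
have gmu i : Num.max (g i x) (- mu 0 i) = 0.
  by have := congr1 (fun u : 'rV[R]_m => u 0 i) gm; rewrite !mxE.
have gmax : vmax (gvec g x) 0 = 0.
  apply/rowP => i; rewrite !mxE max_r//.
  by rewrite -(gmu i) le_max lexx.
have psi0 := psi0_gt0 psi_adm.
have Ox : Omega F g phi psi x.
  split; first by rewrite /slack gmax.
  by rewrite Fx normr0 expr0n phi00 ltry.
have p0 := penalty_weight_gt0 mu Ox.
have q0 : shifted_constraint g psi c x mu = 0.
  apply/rowP => i; rewrite !mxE.
  by have [] := max_eq0 (mulr_gt0 (_ : 0 < c^-1) p0) (gmu i); rewrite ?invr_gt0.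
have dotv0 : dotv mu 0 = 0 by rewrite /dotv big1// => i _; rewrite mxE mulr0.
have enorm0 : enorm (0 : 'rV[R]_m) ^+ 2 = 0.
  by rewrite enorm_sqrE big1// => i _; rewrite mxE expr0n.
have eta0 : Defs.eta f F g x l mu = 0.
  rewrite /Defs.eta gl linear0 normr0 expr0n mulr0 add0r big1 ?mulr0// => i _.
  have [_ gmu0] := max_eq0 ltr01 (gmu i).
  by rewrite inner0r [g i x ^+ 2]expr2 -mulrA gmu0 mulr0 addr0 expr0n.
rewrite /augmented_lagrangian; case: asboolP => // _.
rewrite -/(shifted_constraint g psi c x mu) q0 dotv0 enorm0 eta0 Fx inner0r normr0.
by rewrite expr0n phi00 /= !mulr0 !addr0.
Qed.

Theorem theorem5p6 (R : realType) (X H Y : hilbertType R) (m : nat)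
  (f : X -> R) (F : X -> H) (g : 'I_m -> X -> R)
  (phi : R -> \bar R) (psi : 'rV[R]_m -> R)
  (A : {linear X -> Y}) (F0 : Y -> H) (g0 : 'I_m -> Y -> R)
  (f_C1 : C1 f) (F_C1 : C1 F) (g_C1 : forall i, C1 (g i))
  (phi_adm : phi_admissible phi) (psi_adm : psi_admissible psi)
  (optimal_exists : exists x, globally_optimal f F g x)
  (optimal_KKT : forall x, globally_optimal f F g x ->
     exists l mu, KKT f F g x l mu)
  (A_compact : compact_operator A)
  (F0_C1 : C1 F0) (g0_C1 : forall i, C1 (g0 i))
  (F_factor : forall x, F x = F0 (A x))
  (g_factor : forall i x, g i x = g0 i (A x))
  (f_C2 : C2 f) (F0_C2 : C2 F0) (g0_C2 : forall i, C2 (g0 i))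
  (phi_C1 : exists dphi : R -> R,
     C1_within (edom phi) (fun t => fine (phi t)) (fun t h => dphi t * h) /\
     0 < dphi 0)
  (f_wlsc : weakly_seq_lsc (fun x => (f x)%:E))
  (auglag_wlsc : forall c : R, 0 < c ->
     weakly_seq_lsc (fun z : X * H * 'rV[R]_m =>
       augmented_lagrangian f F g phi psi c z.1.1 z.1.2 z.2))
  (r eps : R) (r_gt0 : 0 < r) (eps_gt0 : 0 < eps)
  (sub_bounded : bounded_set
     (Omega_sub f F g phi psi r (optimal_value f F g + eps)))
  (f_bounded : bounded_up_to_order2 f
     (Omega_sub f F g phi psi r (optimal_value f F g + eps)))
  (g_bounded : forall i, bounded_up_to_order2 (g i)
     (Omega_sub f F g phi psi r (optimal_value f F g + eps)))
  (F_bounded : bounded_up_to_order2 F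
     (Omega_sub f F g phi psi r (optimal_value f F g + eps)))
  (AAstar : forall y, A (adjoint A y) = y)
  (Q0_pd : forall x, globally_optimal f F g x ->
     Q0_positive_definite F0 g0 (A x)) :
  globally_exact f F g phi psi.
Proof.
have f_diff x : differentiable f x by case: f_C1.
have [xs xs_opt] := optimal_exists.
have fs := optimal_valueE xs_opt; rewrite fs in sub_bounded f_bounded.
have psi0 := psi0_gt0 psi_adm.
have [k [alpha [k0 alpha0 phi_fin phi_k]]] := phi_linear_growth phi_adm phi_C1.
(* The one implication gives both directions: a minimiser has value at most [f xs], attained at a
   KKT triple, and a value strictly below [f xs] would belong to a KKT triple, whose value is
   [f xs]. *)
suff [c0 c00 claim] : exists2 c0 : R, 0 < c0 & forall c, c0 <= c -> forall x l mu,
    (augmented_lagrangian f F g phi psi c x l mu <= (f xs)%:E)%E ->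
    globally_optimal f F g x /\ KKT f F g x l mu.
  exists c0 => // c cc0 x l mu.
  have c_gt0 : 0 < c := lt_le_trans c00 cc0.
  have value y l' mu' : globally_optimal f F g y -> KKT f F g y l' mu' ->
      augmented_lagrangian f F g phi psi c y l' mu' = (f xs)%:E.
    move=> y_opt kkt; rewrite auglag_KKT//; last 2 first.
    - by move=> i; case: (g_C1 i).
    - by case: F_C1.
    by rewrite -fs (optimal_valueE y_opt).
  split=> [xmin|[x_opt kkt] y l' mu'].
    have [l' [mu' kkt]] := optimal_KKT _ xs_opt.
    by apply: (claim c) => //; rewrite -(value _ _ _ xs_opt kkt); exact: xmin.
  rewrite (value _ _ _ x_opt kkt) leNgt; apply/negP => lt.
  have [y_opt y_kkt] := claim c cc0 y l' mu' (ltW lt).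
  by move: lt; rewrite (value _ _ _ y_opt y_kkt) ltxx.

(* Contradiction along a sequence of offending triples *)
pose k1 := Num.min (k / 2) (4 * psi 0)^-1.
have k10 : 0 < k1 by rewrite lt_min !divr_gt0// invr_gt0 mulr_gt0.
pose C0 := (2 * k)^-1 + psi 0.
have C00 : 0 < C0 by rewrite addr_gt0// invr_gt0 mulr_gt0.
apply: contrapT => noc.
(* The first two summands give [r <= c k1] and [C0 / c <= eps], which place [x n] in the sublevel
   set of hypothesis (3); the third sends [c n] to infinity. *)
have /choice[w wP] (n : nat) : exists w : R * X * hprod H m,
    [/\ r / k1 + C0 / eps + n.+1%:R <= w.1.1,
      (augmented_lagrangian f F g phi psi w.1.1 w.1.2 w.2.1 w.2.2 <= (f xs)%:E)%E &
      ~ (globally_optimal f F g w.1.2 /\ KKT f F g w.1.2 w.2.1 w.2.2)].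
  apply: contrapT => now; apply: noc.
  exists (r / k1 + C0 / eps + n.+1%:R).
    by rewrite ltr_wpDl// addr_ge0// divr_ge0// ltW.
  move=> c cn x l mu AL; apply: contrapT => bad; apply: now.
  by exists (c, x, ((l, mu) : hprod H m)).
pose c n := (w n).1.1; pose x n := (w n).1.2.
have rk0 : 0 <= r / k1 by rewrite divr_ge0// ltW.
have Ce0 : 0 <= C0 / eps by rewrite divr_ge0// ltW.
have c_ge n : [/\ 0 < c n, r <= c n * k1, C0 / c n <= eps & n.+1%:R <= c n].
  have [cn _ _] := wP n; rewrite -/(c n) in cn.
  have n1 : 0 < n.+1%:R :> R by [].
  have cn0 : 0 < c n by move: cn n1 rk0 Ce0; clear; lra.
  split => //.
  - by rewrite -ler_pdivrMr//; move: cn n1 rk0 Ce0; clear; lra.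
  - rewrite ler_pdivrMr// mulrC -ler_pdivrMr//; move: cn n1 rk0 Ce0; clear; lra.
  - by move: cn n1 rk0 Ce0; clear; lra.
have low n : f (x n) + c n * k1 * (`|F (x n)| ^+ 2 + enorm (vmax (gvec g (x n)) 0) ^+ 2)
    <= f xs + C0 / c n.
  have [_ AL _] := wP n; have [cn0 _ _ _] := c_ge n.
  have := auglag_lower psi_adm k0 cn0 phi_k AL.
  rewrite -/k1 -/C0 -/(c n) -/(x n); set q := shifted_constraint _ _ _ _ _.
  have eta0 : 0 <= Defs.eta f F g (x n) (w n).2.1 (w n).2.2.
    rewrite (etaE f F_factor g_factor F0_C2 g0_C2 AAstar).
    by rewrite mulr_ge0 ?sqr_ge0 ?invr_ge0.
  have gq : enorm (vmax (gvec g (x n)) 0) ^+ 2 <= enorm q ^+ 2.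
    rewrite !enorm_sqrE; apply: ler_sum => i _; rewrite !mxE.
    case: (leP (g i (x n)) 0) => [_|g0i]; first by rewrite expr0n sqr_ge0.
    rewrite ler_sqr ?nnegrE ?(ltW g0i)//; first by rewrite le_max lexx.
    by rewrite le_max (ltW g0i).
  have := ler_wpM2l (mulr_ge0 (ltW cn0) (ltW k10)) gq.
  by move: eta0; clear; lra.
have viol0 n : 0 <= `|F (x n)| ^+ 2 + enorm (vmax (gvec g (x n)) 0) ^+ 2.
  by rewrite addr_ge0 ?sqr_ge0.
have xB n : Omega_sub f F g phi psi r (f xs + eps) (x n).
  have [_ AL _] := wP n; have [Ox _] := auglag_leP AL.
  split=> //; have [_ rc Cc _] := c_ge n.
  by have := ler_wpM2r (viol0 n) rc; have := low n; move: Cc; clear; lra.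
have [M fM] := f_bounded.
pose E := f xs + M + eps.
have vE n : c n * k1 * (`|F (x n)| ^+ 2 + enorm (vmax (gvec g (x n)) 0) ^+ 2) <= E.
  have [+ _ _] := fM _ (xB n); rewrite ler_norml => /andP[+ _].
  have [_ _ Cc _] := c_ge n; rewrite /E; move: (low n) Cc; clear; lra.
have E0 : 0 <= E.
  apply: le_trans (vE 0%N); have [c00 _ _ _] := c_ge 0%N.
  exact: mulr_ge0 (mulr_ge0 (ltW c00) (ltW k10)) (viol0 0%N).
have [s [p [sn xp Axp]]] := bounded_weakly_cvg_subseq
  (fun v y => adjoint_right_inverse_spec AAstar y v) A_compact sub_bounded xB.
(* The violation at [s n] is at most [E / (c (s n) * k1)], and [c (s n) >= n + 1] because
   [n <= s n]. *)
have viol_small (e : R) : 0 < e -> \forall n \near \oo,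
    `|F (x (s n))| ^+ 2 + enorm (vmax (gvec g (x (s n))) 0) ^+ 2 <= e ^+ 2.
  move=> e0; have d0 : 0 < e ^+ 2 * k1 / (E + 1).
    by rewrite divr_gt0 ?mulr_gt0 ?exprn_gt0// ltr_wpDl.
  apply: filterS (near_infty_natSinv_lt (PosNum d0)) => n /=.
  have [cn0 _ _ nc] := c_ge (s n).
  have ns : n.+1%:R <= c (s n) :> R by apply: le_trans nc; rewrite ler_nat ltnS.
  rewrite ltr_pdivlMr ?ltr_wpDl// mulrC ltr_pdivrMr// => h.
  rewrite -(ler_pM2l (mulr_gt0 cn0 k10)); apply: le_trans (vE _) _.
  have : e ^+ 2 * k1 * n.+1%:R <= e ^+ 2 * k1 * c (s n).
    by rewrite ler_wpM2l// mulr_ge0 ?sqr_ge0// ltW.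
  by move: h; clear; lra.
have F_cvg : F (x (s n)) @[n --> \oo] --> F p.
  rewrite F_factor; under eq_fun do rewrite F_factor.
  apply: continuous_cvg => //.
  by apply: differentiable_continuous; case: F0_C1.
have g_cvg i : g i (x (s n)) @[n --> \oo] --> g i p.
  rewrite g_factor; under eq_fun do rewrite g_factor.
  have g0c : {for A p, continuous (g0 i)}.
    by apply: differentiable_continuous; case: (g0_C1 i).
  exact: (cvg_comp _ _ Axp g0c).
have p_feas : feasible F g p.
  split.
    apply/eqP; rewrite -normr_le0; apply/ler_addgt0Pl => e e0; rewrite addr0.
    apply: (cvgr_to_le (cvg_norm F_cvg)); apply: filterS (viol_small e e0) => n h.
    rewrite -ler_sqr ?nnegrE ?(ltW e0)//; apply: le_trans h.
    by rewrite lerDl sqr_ge0.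
  move=> i; apply/ler_addgt0Pl => e e0; rewrite addr0.
  apply: (cvgr_to_le (g_cvg i)); apply: filterS (viol_small e e0) => n h.
  apply: le_trans (_ : vmax (gvec g (x (s n))) 0 0 i <= _).
    by rewrite !mxE le_max lexx.
  rewrite -ler_sqr ?nnegrE ?(ltW e0)//; last exact: orthant_vmax.
  apply: le_trans h; apply: le_trans (sqr_coord_le _ i) _.
  by rewrite lerDr sqr_ge0.
have fp : f p <= f xs.
  apply/ler_addgt0Pl => e e0; rewrite addrC -lee_fin.
  apply: le_trans (f_wlsc _ _ xp) _; apply: limn_einf_le.
  have d0 : 0 < e / C0 by rewrite divr_gt0.
  apply: filterS (near_infty_natSinv_lt (PosNum d0)) => n /=.
  have [cn0 _ _ nc] := c_ge (s n).
  have ns : n.+1%:R <= c (s n) :> R by apply: le_trans nc; rewrite ler_nat ltnS.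
  rewrite ltr_pdivlMr// mulrC ltr_pdivrMr// => h.
  rewrite lee_fin; apply: le_trans (_ : f xs + C0 / c (s n) <= _).
    have := low (s n); have := mulr_ge0 (mulr_ge0 (ltW cn0) (ltW k10)) (viol0 (s n)).
    by clear; lra.
  rewrite lerD2l ler_pdivrMr//; apply: le_trans (ltW h) _.
  by rewrite ler_wpM2l// ltW.
have p_opt : globally_optimal f F g p.
  by split=> // y y_feas; apply: le_trans fp _; exact: xs_opt.2.
have fpE : f p = f xs by rewrite -fs (optimal_valueE p_opt).
have f_bp : bounded_up_to_order2 f (Omega_sub f F g phi psi r (f p + eps)).
  by rewrite fpE.
have [d [c1 [d0 c10 loc]]] := local_exactness phi_adm psi_adm optimal_KKT F_factor
  g_factor f_C2 F0_C2 g0_C2 phi_C1 r_gt0 eps_gt0 AAstar f_bp p_opt (Q0_pd _ p_opt).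
(* A single index suffices: [c (s n) >= c1] and [A (x (s n))] within [d] of [A p] contradict the
   choice of the offending triple. *)
near \oo => n.
have [_ AL] := wP (s n); apply.
apply: (loc (c (s n))).
- have [_ _ _ +] := c_ge (s n); apply: le_trans.
  apply: le_trans (_ : n%:R <= _); first by near: n; exact: nbhs_infty_ger.
  by rewrite ler_nat (leq_trans (sn n)).
- by rewrite distrC; near: n; exact: cvgr_dist_le.
- by rewrite fpE.
Unshelve. all: by end_near. Qed.
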